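(* Let $(M^{n+1},g)$ be a closed Riemannian manifold of dimension $n+1$ with $3\le n+1\le 7$. Then there exist a sequence of Riemannian metrics $\{g_i\}_{i\in\mathbb{N}}$ on $M$ and two sequences of positive real numbers $\{c_i\}_{i\in\mathbb{N}}$ and $\{N_i\}_{i\in\mathbb{N}}$, both tending to infinity, such that: 1) $g_i$ converges to $g$ in the $L^{\frac{n+1}{2}}$-topology; 2) $\#\widetilde{\mathcal{P}}^{c_i}_{g_i}\ge N_i$ for every $i$.
   Context: Almost embedded hypersurface: (the image of) a smooth immersion $\phi:\Sigma^{n}\to M$ such that for every $p\in\phi(\Sigma)$ where $\phi$ fails to be embedded there is a neighborhood $U$ of $p$ such that $\Sigma\cap\phi^{-1}(U)$ is a disjoint union of finitely many pieces $\Sigma_1,\dots,\Sigma_l$, $\phi$ restricted to each $\Sigma_i$ is an embedding, and for each $i$ every other $\phi(\Sigma_j)$, $j\ne i$, lies on one side of $\phi(\Sigma_i)$. A hypersurface is a $c$-CMC hypersurface of $(M,g)$ if it is a critical point of the functional $\mathrm{Area}-c\,\mathrm{Vol}$, i.e. has constant mean curvature $c$ with respect to a unit normal. For $\Omega$ with smooth boundary, $\partial\Omega$ is $c$-CMC with respect to the inward unit normal of $\Omega$ if $\int_{\partial\Omega}\mathrm{div}_{\partial\Omega}X\,d\mathcal{H}^n=c\int_{\partial\Omega}g(X,\nu_{\partial\Omega})\,d\mathcal{H}^n$ for all vector fields $X$, where $\nu_{\partial\Omega}$ is the outward unit normal. For a metric $g$ on $M$ and $c>0$, $\widetilde{\mathcal{P}}^{c}_{g}$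 is the class of open sets $\Omega\subset M$ such that $\partial\Omega$ is a smooth, closed, almost embedded $c$-CMC hypersurface in $(M,g)$ with respect to the inward unit normal of $\Omega$. $\#$ denotes cardinality. Convergence in the $L^{\frac{n+1}{2}}$-topology means $\|g_i-g\|_{L^{\frac{n+1}{2}}(M,g)}=\left(\int_M|g_i-g|_g^{\frac{n+1}{2}}\,d\mathcal{H}^{n+1}_g\right)^{\frac{2}{n+1}}\to0$, where $|\cdot|_g$ is the pointwise norm on symmetric 2-tensors induced by $g$. *)

(* Defs.v *)
From HB Require Import structures.
From mathcomp Require Import all_boot all_order all_algebra.
From mathcomp Require Import all_classical all_reals all_analysis.

Set Implicit Arguments.
Unset Strict Implicit.
Unset Printing Implicit Defensive.

Import Order.TTheory GRing.Theory Num.Theory.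
Import numFieldNormedType.Exports.

Local Open Scope classical_set_scope.
Local Open Scope ring_scope.

Section Smoothness.
Context {R : realType}.

(* Meant for open U only: the derivatives at a point of U use the values of f
   near that point. *)
Fixpoint Ck {V W : normedModType R} (k : nat) (U : set V) (f : V -> W) : Prop :=
  (forall x, U x -> {for x, continuous f}) /\
  if k is k'.+1 then
    forall v : V, (forall x, U x -> derivable f x v) /\ Ck k' U ('D_v f)
  else True.

Definition smooth_on {V W : normedModType R} (U : set V) (f : V -> W) : Prop :=
  forall k, Ck k U f.

End Smoothness.

Section Manifolds.
Context {R : realType}.

(* A smooth n-manifold without boundary, given by an atlas; the atlas need not
   be maximal.  par i is the inverse of chart i on the image of dom i, and is
   arbitrary elsewhere. *)
Record manifold (n : nat) := Manifold {
  carrier :> topologicalType;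
  idx : Type;
  dom : idx -> set carrier;
  chart : idx -> carrier -> 'rV[R]_n;
  par : idx -> 'rV[R]_n -> carrier;
  carrier_hausdorff : hausdorff_space carrier;
  carrier_second_countable : @second_countable carrier;
  dom_open : forall i, open (dom i);
  img_open : forall i, open (chart i @` dom i);
  chartK : forall i x, dom i x -> par i (chart i x) = x;
  chart_continuous : forall i x, dom i x -> {for x, continuous (chart i)};
  par_continuous : forall i y, (chart i @` dom i) y -> {for y, continuous (par i)};
  chart_cover : forall x, exists i, dom i x;
  transition_smooth : forall i j,
      smooth_on (chart i @` (dom i `&` dom j)) (chart j \o par i)
}.

Definition closed_manifold n (M : manifold n) : Prop :=
  compact [set: M] /\ [set: M] !=set0.

Definition img n (M : manifold n) (i : idx M) : set 'rV[R]_n :=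
  chart i @` dom i.

Definition chart_at n (M : manifold n) (x : M) : idx M :=
  sval (cid (chart_cover x)).

(* A tangent vector at x with components v (a row) in chart i has components
   v *m transition i j x in chart j. *)
Definition transition n (M : manifold n) (i j : idx M) (x : M) : 'M[R]_n :=
  'J (chart j \o par i) (chart i x).

Definition loc m n (S : manifold m) (M : manifold n) (phi : S -> M)
    (i : idx S) (j : idx M) : 'rV[R]_m -> 'rV[R]_n :=
  chart j \o phi \o par i.

Definition smooth_map m n (S : manifold m) (M : manifold n) (phi : S -> M) :
    Prop :=
  continuous phi /\
  forall i j, smooth_on (chart i @` (dom i `&` phi @^-1` dom j)) (loc phi i j).

Definition smooth_function n (M : manifold n) (f : M -> R) : Prop :=
  forall i : idx M, smooth_on (img i) (f \o par i).

Definition immersion m n (S : manifold m) (M : manifold n) (phi : S -> M) :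
    Prop :=
  smooth_map phi /\
  forall x i j, dom i x -> dom j (phi x) ->
    row_free ('J (loc phi i j) (chart i x)).

(* metric_mx i x is the Gram matrix at x of the coordinate frame of chart i. *)
Record metric n (M : manifold n) := Metric {
  metric_mx : idx M -> M -> 'M[R]_n;
  metric_smooth : forall i, smooth_on (img i) (metric_mx i \o par i);
  metric_sym : forall i x, dom i x -> (metric_mx i x)^T = metric_mx i x;
  metric_pos : forall i x (v : 'rV[R]_n),
      dom i x -> v != 0 -> 0 < (v *m metric_mx i x *m v^T) 0 0;
  metric_change : forall i j x, dom i x -> dom j x ->
      metric_mx i x =
        transition i j x *m metric_mx j x *m (transition i j x)^T
}.

(* |g' - g|_g at x: in any chart, |h|_g^2 = g^{ab} g^{cd} h_{ac} h_{bd}. *)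
Definition metric_dist n (M : manifold n) (g g' : metric M) (x : M) : R :=
  let i := chart_at x in
  let Ginv := invmx (metric_mx g i x) in
  let h := metric_mx g' i x - metric_mx g i x in
  Num.sqrt (\tr (Ginv *m h *m Ginv *m h)).

(* Lebesgue integral over R^n as an iterated integral; it is only used for
   continuous functions with compact support. *)
Fixpoint integral_rV (n : nat) : ('rV[R]_n -> R) -> R :=
  match n with
  | 0 => fun f => f 0
  | m.+1 => fun f =>
      (\int[@lebesgue_measure R]_t
         integral_rV (fun y : 'rV[R]_m => f (row_mx (t%:M : 'M[R]_1) y)))%R
  end.

Definition partition_of_unity n (M : manifold n) l
    (ch : 'I_l -> idx M) (chi : 'I_l -> M -> R) : Prop :=
  [/\ forall k, smooth_function (chi k),
      forall k x, 0 <= chi k x,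
      forall k, closure [set x | chi k x != 0] `<=` dom (ch k)
    & forall x, \sum_(k < l) chi k x = 1].

(* I is the integral of the continuous function F against the Riemannian
   volume (the top-dimensional Hausdorff measure) of g on the compact manifold
   M.  By the change of variables formula, I does not depend on the partition
   of unity. *)
Definition is_integral n (M : manifold n) (g : metric M) (F : M -> R) (I : R) :
    Prop :=
  exists l (ch : 'I_l -> idx M) (chi : 'I_l -> M -> R),
    partition_of_unity ch chi /\
    I = \sum_(k < l) integral_rV
          ((fun y => let x := par (ch k) y in
             chi k x * F x * Num.sqrt (\det (metric_mx g (ch k) x)))
           \_ (img (ch k))).

(* L is the L^p(M, g) norm of the tensor g' - g. *)
Definition is_Lnorm n (M : manifold n) (g g' : metric M) (p L : R) : Prop :=
  exists2 I, is_integral g (fun x => metric_dist g g' x `^ p) I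
           & L = I `^ p^-1.

Definition Lcvg n (M : manifold n) (p : R) (gs : nat -> metric M)
    (g : metric M) : Prop :=
  exists L : nat -> R,
    (forall i, is_Lnorm g (gs i) p (L i)) /\ L i @[i --> \oo] --> (0 : R).

(* For an immersion, a topological embedding is a smooth embedding. *)
Definition embedding_on (S T : topologicalType) (phi : S -> T) (A : set S) :
    Prop :=
  set_inj A phi /\
  forall V, open V ->
    exists2 W, open W & phi @` (A `&` V) = (phi @` A) `&` W.

Definition embedded_at (S T : topologicalType) (phi : S -> T) (p : T) : Prop :=
  exists U, [/\ open U, U p & embedding_on phi (phi @^-1` U)].

(* P divides U into two sides A and B, and Q lies on side A, possibly touching
   P.  Since A and B are connected and both accumulate at all of P, near each
   point of P they are the two local sides of the hypersurface P. *)
Definition lies_on_one_side (T : topologicalType) (U P Q : set T) : Prop :=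
  exists A B : set T,
    [/\ [/\ open A, open B, connected A & connected B],
        A `&` B = set0, U `\` P = A `|` B,
        P `<=` closure A `&` closure B
      & Q `<=` P `|` A].

Definition almost_embedded m n (S : manifold m) (M : manifold n)
    (phi : S -> M) : Prop :=
  immersion phi /\
  forall p, range phi p -> ~ embedded_at phi p ->
    exists (U : set M) (l : nat) (P : 'I_l -> set S),
      [/\ open U /\ U p,
          (forall k, open (P k)) /\ trivIset setT P,
          phi @^-1` U = \bigcup_k P k,
          forall k, embedding_on phi (P k)
        & forall k k', k' != k ->
            lies_on_one_side U (phi @` P k) (phi @` P k')].

Definition boundary (T : topologicalType) (A : set T) : set T :=
  closure A `\` interior A.

Section Hypersurfaces.
Variables (n : nat) (S : manifold n) (M : manifold n.+1) (g : metric M).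
Variable phi : S -> M.

(* eta j x : components in chart j of M of a vector in T_(phi x) M *)
Definition unit_normal_field (eta : idx M -> S -> 'rV[R]_n.+1) : Prop :=
  [/\ forall j k x, dom j (phi x) -> dom k (phi x) ->
        eta k x = eta j x *m transition j k (phi x),
      forall i j, smooth_on (chart i @` (dom i `&` phi @^-1` dom j))
                            (eta j \o par i),
      forall j x, dom j (phi x) ->
        (eta j x *m metric_mx g j (phi x) *m (eta j x)^T) 0 0 = 1
    & forall i j x, dom i x -> dom j (phi x) ->
        'J (loc phi i j) (chart i x) *m metric_mx g j (phi x) *m (eta j x)^T
          = 0].

(* At a point where phi is embedded, eta points into Om and -eta out of Om.
   At a touching point, -eta may also point into Om, but then -eta is the value
   of the field on another sheet through the same point. *)
Definition inward_unit_normal (Om : set M) (eta : idx M -> S -> 'rV[R]_n.+1) :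
    Prop :=
  unit_normal_field eta /\
  forall j x, dom j (phi x) ->
    (\forall t \near 0^'+, Om (par j (chart j (phi x) + t *: eta j x))) /\
    ((\forall t \near 0^'+, ~ Om (par j (chart j (phi x) - t *: eta j x))) \/
     (exists2 y, phi y = phi x & eta j y = - eta j x)).

Definition christoffel (j : idx M) (z : 'rV[R]_n.+1) (k a b : 'I_n.+1) : R :=
  let G := metric_mx g j \o par j in
  let dG (l a b : 'I_n.+1) : R := ('D_(delta_mx 0 l) G z) a b in
  2^-1 * \sum_l invmx (G z) k l * (dG a b l + dG b a l - dG l a b).

(* Covariant derivative of the coordinate field d_b phi in the direction of
   d_a phi, in chart i of S and chart j of M. *)
Definition cov_deriv (i : idx S) (j : idx M) (x : S) (a b : 'I_n) :
    'rV[R]_n.+1 :=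
  let f := loc phi i j in
  let y := chart i x in
  let df (a : 'I_n) := 'D_(delta_mx 0 a) f in
  'D_(delta_mx 0 a) (df b) y +
  \row_k \sum_p \sum_q
     christoffel j (f y) k p q * (df a y) 0 p * (df b y) 0 q.

(* Mean curvature at x with respect to eta: the trace (not normalised) of the
   second fundamental form g(nabla_a d_b phi, eta).  The unit sphere of
   R^(n+1) has mean curvature n with respect to its inward unit normal, and in
   general this is the tangential divergence of the opposite normal -eta. *)
Definition mean_curvature (eta : idx M -> S -> 'rV[R]_n.+1)
    (i : idx S) (j : idx M) (x : S) : R :=
  let G := metric_mx g j (phi x) in
  let J := 'J (loc phi i j) (chart i x) in
  let h := J *m G *m J^T in
  \sum_a \sum_b
     invmx h a b * (cov_deriv i j x a b *m G *m (eta j x)^T) 0 0.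

Definition has_cmc (c : R) (eta : idx M -> S -> 'rV[R]_n.+1) : Prop :=
  forall i j x, dom i x -> dom j (phi x) -> mean_curvature eta i j x = c.

End Hypersurfaces.

Definition Ptilde n (M : manifold n.+1) (g : metric M) (c : R) :
    set (set M) :=
  [set Om | open Om /\
    exists (S : manifold n) (phi : S -> M) eta,
      [/\ closed_manifold S, almost_embedded phi, range phi = boundary Om,
          inward_unit_normal g phi Om eta & has_cmc g phi c eta]].

(* The cardinality of A, possibly infinite, is at least x. *)
Definition card_ge (T : Type) (A : set T) (x : R) : Prop :=
  exists2 m : nat, x <= m%:R & (`I_m #<= A)%card.

End Manifolds.

Arguments manifold R n : clear implicits.

(* Main.v *)
From HB Require Import structures.
Require Import Defs.
From mathcomp Require Import all_boot all_order all_algebra.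
From mathcomp Require Import all_classical all_reals all_analysis.
From mathcomp Require Import ring lra.

Set Implicit Arguments.
Unset Strict Implicit.
Unset Printing Implicit Defensive.

Import Order.TTheory GRing.Theory Num.Theory.
Import numFieldNormedType.Exports.

Local Open Scope classical_set_scope.
Local Open Scope ring_scope.

(* The topology of L^((n+1)/2) is so weak that a metric can be changed
   arbitrarily, within a fixed bound, on a ball shrinking to a point.  Fix a
   chart i0 around a point p0 and interpolate, by a cutoff of scale rho, between
   g and the Euclidean metric of the chart: the new metric is flat on a ball of
   radius comparable to rho, and its distance to g in L^((n+1)/2) is O(rho^2).
   The coordinate spheres of radius r in the flat ball are embedded, bound a
   ball and have constant mean curvature n / r.  With r = rho / (2 (i + 1)) there
   is room for i + 1 different translates; let rho tend to zero.

   The mean curvature has to be computed in every chart j.  There the flat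
   metric is G = JF JF^T, with F the transition map to i0, and its Christoffel
   symbols are those for which (cov_deriv) JF is the ordinary second derivative
   of the immersion read in i0. *)

(** * Calculus of C^k maps *)

(** The rate O(rho^2) is pure scaling: |g' - g|_g is bounded near p0 independently of rho and lives
    on a set of volume O(rho^(n+1)), and the power 1/p with p = (n+1)/2 turns rho^(n+1) into rho^2.
    The translated spheres may cross one another: each ball is an element of the class by itself, so
    distinctness is all that is required of them. Every single sphere is embedded, which leaves the
    touching clauses of the definitions idle. With rho = rho1 / (i + 1) the curvature is n / r = 2 n
    (i + 1)^2 / rho1.

    What shapes the proof is the form of the definitions. [Ck] speaks of iterated directional
    derivatives, whereas Jacobians and the chain rule need total differentials; hence C^1 maps are
    first shown to be differentiable and second derivatives to be symmetric, the latter being what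
    makes the Christoffel symbols of JF JF^T computable. Normal, metric and curvature are prescribed
    in all charts j, so each computation is carried to i0 by transition matrices. Integrals are
    iterated ones, and only upper bounds on them are ever required. *)

Section CkBasics.
Context {R : realType}.
Implicit Types (V W : normedModType R).

Lemma Ck_sub V W k (U U' : set V) (f : V -> W) :
  U' `<=` U -> Ck k U f -> Ck k U' f.
Proof.
move=> sU; elim: k f => [|k IH] f [fc fd]; split=> //; try by move=> x /sU /fc.
by move=> v; have [fd1 fd2] := fd v; split=> [x /sU /fd1//|]; exact: IH.
Qed.

(** Each clause of [Ck] is a condition at single points, on derivatives taken in the whole space; a
    piece chosen separately for each point therefore suffices. *)
Lemma Ck_local V W k (U : set V) (f : V -> W) :
  (forall x, U x -> exists2 U', U' x & Ck k U' f) -> Ck k U f.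
Proof.
elim: k f => [|k IH] f h; split => //.
- by move=> x /h [U' U'x [+ _]]; exact.
- by move=> x /h [U' U'x [+ _]]; exact.
- move=> v; split; first by move=> x /h [U' U'x [_ /(_ v)[+ _]]]; exact.
  by apply: IH => x /h [U' U'x [_ /(_ v)[_ ?]]]; exists U'.
Qed.

Lemma open_near V (U : set V) x (P : V -> Prop) :
  open U -> U x -> (forall y, U y -> P y) -> \near x, P x.
Proof. by move=> oU Ux h; apply: filterS (open_nbhs_nbhs (conj oU Ux)). Qed.

Lemma eq_continuous_at V W (U : set V) (f g : V -> W) x :
  open U -> U x -> (forall x, U x -> f x = g x) ->
  {for x, continuous f} -> {for x, continuous g}.
Proof.
move=> oU Ux fg; rewrite /prop_for /continuous_at -(fg x Ux) => fc.
apply: cvg_trans fc; apply: near_eq_cvg.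
exact: (open_near (P := fun y => f y = g y) oU Ux).
Qed.

Lemma Ck_eq V W k (U : set V) (f g : V -> W) :
  open U -> (forall x, U x -> f x = g x) -> Ck k U f -> Ck k U g.
Proof.
move=> oU; elim: k f g => [|k IH] f g fg [fc fd]; split => //.
- by move=> x Ux; apply: (eq_continuous_at oU Ux fg); exact: fc.
- by move=> x Ux; apply: (eq_continuous_at oU Ux fg); exact: fc.
- move=> v; have [fd1 fd2] := fd v; split.
    move=> x Ux; apply: near_eq_derivable (fd1 x Ux).
    exact: (open_near oU Ux fg).
  apply: IH fd2 => x Ux; apply: near_eq_derive.
  exact: (open_near (P := fun y => f y = g y) oU Ux fg).
Qed.

Lemma CkW V W k (U : set V) (f : V -> W) : Ck k.+1 U f -> Ck k U f.
Proof.
elim: k f => [|k IH] f [fc fd]; split=> // v.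
by have [? ?] := fd v; split=> //; exact: IH.
Qed.

Lemma Ck_cont V W k (U : set V) (f : V -> W) : Ck k U f ->
  forall x, U x -> {for x, continuous f}.
Proof. by case: k => [|k] []. Qed.

Lemma Ck_cst V W k (U : set V) (a : W) : Ck k U (fun _ : V => a).
Proof.
elim: k a => [|k IH] a; split=> //; try by move=> x _; exact: cst_continuous.
move=> v; split; first by move=> x _; exact: derivable_cst.
have -> : 'D_v (fun=> a) = (fun _ : V => 0 : W) by apply/funext => x; exact: derive_cst.
exact: IH.
Qed.

Lemma Ck_lin V W k (U : set V) (f : {linear V -> W}) :
  continuous f -> Ck k U f.
Proof.
move=> fc; case: k => [|k]; split=> //; try by move=> x _; exact: fc.
move=> v; have df x : differentiable f x by exact: linear_differentiable.
split; first by move=> x _; apply: diff_derivable.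
have -> : 'D_v f = (fun _ => f v).
  by apply/funext => x; rewrite deriveE// diff_lin.
exact: Ck_cst.
Qed.

Lemma Ck_add V W k (U : set V) (f g : V -> W) :
  open U -> Ck k U f -> Ck k U g -> Ck k U (fun x => f x + g x).
Proof.
move=> oU; elim: k f g => [|k IH] f g [fc fd] [gc gd]; split => //.
- by move=> x Ux; apply: continuousD; [exact: fc|exact: gc].
- by move=> x Ux; apply: continuousD; [exact: fc|exact: gc].
- move=> v; have [fd1 fd2] := fd v; have [gd1 gd2] := gd v; split.
    by move=> x Ux; apply: derivableD; [exact: fd1|exact: gd1].
  apply: (@Ck_eq _ _ _ _ (fun x => 'D_v f x + 'D_v g x)) => //; last exact: IH.
  by move=> x Ux; rewrite -deriveD//; [exact: fd1|exact: gd1].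
Qed.

Lemma Ck_sum V W k (U : set V) (I : Type) (r : seq I) (P : pred I) (f : I -> V -> W) :
  open U -> (forall i, P i -> Ck k U (f i)) ->
  Ck k U (fun x => \sum_(i <- r | P i) f i x).
Proof.
move=> oU fi; elim: r => [|i r IH].
  by apply: (@Ck_eq _ _ _ _ (fun _ => 0)) => //; [move=> x _; rewrite big_nil|exact: Ck_cst].
have [Pi|Pi] := boolP (P i); last first.
  by apply: Ck_eq IH => // x _; rewrite big_cons (negbTE Pi).
apply: (@Ck_eq _ _ _ _ (fun x => f i x + \sum_(i <- r | P i) f i x)) => //.
  by move=> x _; rewrite big_cons Pi.
by apply: Ck_add => //; exact: fi.
Qed.

Lemma Ck_mul V k (U : set V) (f g : V -> R) :
  open U -> Ck k U f -> Ck k U g -> Ck k U (fun x => f x * g x).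
Proof.
move=> oU; elim: k f g => [|k IH] f g Cf Cg; have [fc fd] := Cf; have [gc gd] := Cg; split => //.
- by move=> x Ux; apply: continuousM; [exact: fc|exact: gc].
- by move=> x Ux; apply: continuousM; [exact: fc|exact: gc].
- move=> v; have [fd1 fd2] := fd v; have [gd1 gd2] := gd v; split.
    by move=> x Ux; apply: derivableM; [exact: fd1|exact: gd1].
  apply: (@Ck_eq _ _ _ _ (fun x => f x * 'D_v g x + g x * 'D_v f x)) => //; last first.
    by apply: Ck_add => //; apply: IH => //; exact: CkW.
  by move=> x Ux; rewrite [RHS](deriveM (fd1 x Ux) (gd1 x Ux)).
Qed.

Lemma Ck_opp V k (U : set V) (f : V -> R) :
  open U -> Ck k U f -> Ck k U (fun x => - f x).
Proof.
move=> oU Cf; apply: (@Ck_eq _ _ _ _ (fun x => -1 * f x)) => //.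
  by move=> x _; rewrite mulN1r.
by apply: Ck_mul => //; exact: Ck_cst.
Qed.

Lemma Ck_inv V k (U : set V) (f : V -> R) :
  open U -> (forall x, U x -> f x != 0) -> Ck k U f ->
  Ck k U (fun x => (f x)^-1).
Proof.
move=> oU f0; elim: k => [|k IH] Cf; have [fc fd] := Cf; split => //.
- by move=> x Ux; apply: continuousV; [exact: f0|exact: fc].
- by move=> x Ux; apply: continuousV; [exact: f0|exact: fc].
- move=> v; have [fd1 fd2] := fd v; split.
    by move=> x Ux; apply: derivableV; [exact: f0|exact: fd1].
  apply: (@Ck_eq _ _ _ _ (fun x => - ((f x)^-1 * (f x)^-1 * 'D_v f x))) => //; last first.
    by apply: Ck_opp => //; do 2 apply: Ck_mul => //; apply: IH; exact: CkW.
  move=> x Ux; rewrite (deriveV (f0 x Ux) (fd1 x Ux)).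
  by rewrite expr2 invfM scaleNr.
Qed.

Lemma Ck_prod V k (U : set V) (I : Type) (r : seq I) (P : pred I) (f : I -> V -> R) :
  open U -> (forall i, P i -> Ck k U (f i)) ->
  Ck k U (fun x => \prod_(i <- r | P i) f i x).
Proof.
move=> oU fi; elim: r => [|i r IH].
  by apply: (@Ck_eq _ _ _ _ (fun _ => 1 : R)) => //; [move=> x _; rewrite big_nil|exact: Ck_cst].
have [Pi|Pi] := boolP (P i); last first.
  by apply: Ck_eq IH => // x _; rewrite big_cons (negbTE Pi).
apply: (@Ck_eq _ _ _ _ (fun x => f i x * \prod_(i <- r | P i) f i x)) => //.
  by move=> x _; rewrite big_cons Pi.
by apply: Ck_mul => //; exact: fi.
Qed.

Lemma mx_continuousP (T : topologicalType) m n (f : T -> 'M[R]_(m, n)) x :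
  {for x, continuous f} <-> forall i j, {for x, continuous (fun x => f x i j)}.
Proof.
split=> [fc i j|fc].
  by apply: (@continuous_comp _ _ _ f (fun M : 'M[R]_(m, n) => M i j)) => //; exact: coord_continuous.
apply/cvgrPdist_le => /= e e0; near=> t.
rewrite [leLHS]/Num.Def.normr/= mx_normrE (bigmax_le _ (ltW e0))//= => i _.
rewrite !mxE/=; move: i; near: t; apply: filter_forall => /= i.
exact: ((cvgrPdist_le _ _).1 (fc i.1 i.2)).
Unshelve. all: by end_near. Qed.

Lemma Ck_mxP V m n k (U : set V) (f : V -> 'M[R]_(m, n)) : open U ->
  Ck k U f <-> forall i j, Ck k U (fun x => f x i j).
Proof.
move=> oU; split.
- elim: k f => [|k IH] f [fc fd] i j; split=> //.
  + by move=> x /fc /mx_continuousP.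
  + by move=> x /fc /mx_continuousP.
  + move=> v; have [fd1 fd2] := fd v; split; first by move=> x /fd1 /derivable_mxP.
    apply: Ck_eq (IH _ fd2 i j) => // x Ux.
    by rewrite (derive_mx (fd1 x Ux)) mxE.
- elim: k f => [|k IH] f fd; split=> //.
  + by move=> x Ux; apply/mx_continuousP => i j; have [+ _] := fd i j; exact.
  + by move=> x Ux; apply/mx_continuousP => i j; have [+ _] := fd i j; exact.
  + move=> v; have fd1 x : U x -> derivable f x v.
      by move=> Ux; apply/derivable_mxP => i j; have [_ /(_ v)[+ _]] := fd i j; exact.
    split=> //; apply: IH => i j; have [_ /(_ v)[_]] := fd i j.
    by apply: Ck_eq => // x Ux; rewrite (derive_mx (fd1 x Ux)) mxE.
Qed.

End CkBasics.

(** * Mean value theorem, differentiability of C^1 maps, chain rule *)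

Section Differentiability.
Context {R : realType}.
Implicit Types (V W : normedModType R).

Lemma is_derive_line V W (f : V -> W) (a v : V) (t : R) :
  derivable f (a + t *: v) v ->
  is_derive t 1 (fun s => f (a + s *: v)) ('D_v f (a + t *: v)).
Proof.
have E : (fun h : R => h^-1 *: (((fun s => f (a + s *: v)) \o shift t) (h *: 1) -
    f (a + t *: v))) =
    (fun h : R => h^-1 *: ((f \o shift (a + t *: v)) (h *: v) - f (a + t *: v))).
  apply/funext => h /=; congr (_ *: (f _ - _)).
  by rewrite [h%:A]mulr1 scalerDl addrCA.
by move=> df; apply: DeriveDef; rewrite /derivable /derive E.
Qed.

(** Locating t only by [|t| <= |s|] treats both signs of s at once; the one-variable theorem is
    applied on [0, s] or on [s, 0]. *)
Lemma mvt_line V (f : V -> R) (a v : V) (s : R) :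
  (forall t, `|t| <= `|s| -> derivable f (a + t *: v) v) ->
  exists2 t, `|t| <= `|s| & f (a + s *: v) - f a = s * 'D_v f (a + t *: v).
Proof.
move=> df; pose g (t : R) : R := f (a + t *: v).
have g0 : g 0 = f a by rewrite /g scale0r addr0.
have dg (t : R) : `|t| <= `|s| -> is_derive t (1 : R) g ('D_v f (a + t *: v)).
  by move=> /df; exact: is_derive_line.
have main (b c : R) : b <= c -> (forall t, t \in `[b, c] -> `|t| <= `|s|) ->
    exists2 t, `|t| <= `|s| & g c - g b = 'D_v f (a + t *: v) * (c - b).
  move=> bc H; have [|||t tbc ->] := @MVT_segment R g (fun t => 'D_v f (a + t *: v)) b c.
  - by [].
  - move=> t tbc; apply: dg; apply: H; exact: subset_itv_oo_cc tbc.
  - by apply: derivable_within_continuous => t /H /dg [].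
  - by exists t => //; exact: H.
have [s0|s0] := leP 0 s.
  have [t|t ts e] := main 0 s s0.
    by rewrite in_itv /= => /andP[t0 t1]; rewrite !ger0_norm.
  by exists t => //; rewrite mulrC -[s in RHS]subr0 -e g0.
have [t|t ts e] := main s 0 (ltW s0).
  by rewrite in_itv /= => /andP[t0 t1]; rewrite !ler0_norm ?lerN2 // ltW.
exists t => //; apply: oppr_inj; rewrite opprB -g0 -[f _]/(g s) e sub0r mulrN mulrC //.
Qed.


Lemma derive_shiftx V W (f : V -> W) (a b v : V) :
  'D_v (fun y => f (y + b)) a = 'D_v f (a + b).
Proof.
rewrite /derive; set F := (X in lim (X @ _)); set G := (X in _ = lim (X @ _)).
by have -> : F = G by apply/funext => h; rewrite /F /G /= addrA.
Qed.

Lemma derivable_shiftx V W (f : V -> W) (a b v : V) :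
  derivable f (a + b) v -> derivable (fun y => f (y + b)) a v.
Proof.
rewrite /derivable => df.
suff -> : (fun h : R => h^-1 *: (((fun y => f (y + b)) \o shift a) (h *: v) - f (a + b))) =
  (fun h : R => h^-1 *: ((f \o shift (a + b)) (h *: v) - f (a + b))) by [].
by apply/funext => h /=; rewrite addrA.
Qed.

Lemma rV_coord_le n (h : 'rV[R]_n) k : `|h 0 k| <= `|h|.
Proof.
rewrite [leRHS]/Num.Def.normr/= mx_normrE.
exact: (le_bigmax _ (fun ij : 'I_1 * 'I_n => `|h ij.1 ij.2|) (0, k)).
Qed.

Lemma rV_norm_le n (h : 'rV[R]_n) (e : R) : 0 <= e ->
  (forall k, `|h 0 k| <= e) -> `|h| <= e.
Proof.
move=> e0 he; rewrite [leLHS]/Num.Def.normr/= mx_normrE bigmax_le// => -[i k] _ /=.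
by rewrite (ord1 i).
Qed.

Definition coord_form n (c : 'I_n -> R) (h : 'rV[R]_n) : R := \sum_k h 0 k * c k.

Lemma coord_form_is_linear n (c : 'I_n -> R) : linear (coord_form c : 'rV[R]_n -> R).
Proof.
move=> a u v; rewrite /coord_form scaler_sumr -big_split /=; apply: eq_bigr => k _.
by rewrite !mxE mulrDl -mulrA.
Qed.

HB.instance Definition _ n (c : 'I_n -> R) :=
  GRing.isLinear.Build R 'rV[R]_n R _ (coord_form c) (coord_form_is_linear c).

Lemma coord_form_continuous n (c : 'I_n -> R) : continuous (coord_form c).
Proof.
have : Ck 0 setT (coord_form c); last by move/Ck_cont => h x; exact: h.
apply: Ck_sum => // [|k _]; first exact: openT.
apply: Ck_mul => //; [exact: openT| |exact: Ck_cst].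
by split=> // x _; exact: coord_continuous.
Qed.

(** A continuous linear candidate with error o(|h|) must be the differential; [diff_unique]
    identifies the two. *)
Lemma differentiable_intro V W (f : V -> W) (df : {linear V -> W}) x :
  continuous df ->
  (forall e : R, 0 < e -> \forall h \near 0, `|f (h + x) - f x - df h| <= e * `|h|) ->
  differentiable f x.
Proof.
move=> dfc H.
have Ef : f \o shift x = cst (f x) + df +o_ 0 id.
  apply/eqaddoP => e e0; apply: filterS (H e e0) => h.
  by rewrite -addrA -opprD.
have D := diff_unique dfc Ef.
by apply/diff_locallyP; rewrite D.
Qed.

(* The increment f (x + h) - f x telescopes along the coordinates of h; the mean
   value theorem applies to each term. *)
Lemma C1_differentiable n (U : set 'rV[R]_n) (f : 'rV[R]_n -> R) x :
  open U -> U x -> Ck 1 U f -> differentiable f x.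
Proof.
move=> oU Ux [_ Cf].
pose c k := 'D_(delta_mx 0 k) f x.
apply: (@differentiable_intro _ _ f (coord_form c)); first exact: coord_form_continuous.
move=> _/posnumP[e].
  (* Each of the n terms of the telescoping sum may cost e / (n + 1) times |h|; n + 1 instead of n
     keeps the quotient meaningful for n = 0. *)
  have n0 : (0 : R) < n.+1%:R by [].
  have /nbhs_ballP[r /= r0 rU] : \forall y \near x, U y /\
      forall k, `|'D_(delta_mx 0 k) f y - c k| <= e%:num / n.+1%:R.
    near=> y; split; first by near: y; exact: open_near oU Ux _.
    near: y; apply: filter_forall => k.
    have [_ [+ _]] := Cf (delta_mx 0 k) => /(_ x Ux).
    move=> /cvgrPdist_le /(_ _ (divr_gt0 (gt0 e) n0)).
    by apply: filterS => y; rewrite distrC.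
  have hr0 : \forall h \near (0 : 'rV[R]_n), `|h| < r by exact: pseudometric_normed_Zmodule.nbhs0_lt.
  near=> h.
  have hr : `|h| < r by near: h; exact: hr0.
  (* [p k] keeps the first k coordinates of h. In the sup norm such truncations, and the segments
     joining consecutive ones, are no longer than h, so they stay in the ball where the partial
     derivatives are controlled. *)
  pose p k : 'rV[R]_n := \row_j (if (j < k)%N then h 0 j else 0).
  have p0 : p 0%N = 0 by apply/rowP => j; rewrite !mxE.
  have pn : p n = h by apply/rowP => j; rewrite !mxE ltn_ord.
  have pS (k : 'I_n) : p k.+1 = p k + h 0 k *: delta_mx 0 k.
    apply/rowP => j; rewrite !mxE eqxx /= ltnS leq_eqVlt.
    by have [->|jk] := eqVneq j k; rewrite ?ltnn ?eqxx ?mulr1 ?add0r //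
      (negbTE (jk : nat_of_ord j != k)) /= mulr0 addr0.
  have pb (k : 'I_n) t : `|t| <= `|h 0 k| -> `|p k + t *: delta_mx 0 k| <= `|h|.
    move=> th; apply: rV_norm_le => // j; rewrite !mxE eqxx /=.
    have [->|jk] := eqVneq j k; first by rewrite ltnn add0r mulr1 (le_trans th) ?rV_coord_le.
    by rewrite mulr0 addr0; case: ifP => _; rewrite ?normr0 ?rV_coord_le.
  have inU (k : 'I_n) t : `|t| <= `|h 0 k| ->
      U (x + p k + t *: delta_mx 0 k) /\
      `|'D_(delta_mx 0 k) f (x + p k + t *: delta_mx 0 k) - c k| <= e%:num / n.+1%:R.
    move=> th; have [|? /(_ k)] := rU (x + p k + t *: delta_mx 0 k); last by [].
    rewrite -ball_normE /= -addrA opprD addNKr normrN.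
    exact: le_lt_trans (pb k t th) hr.
  have -> : f (h + x) - f x = \sum_(k < n) (f (x + p k.+1) - f (x + p k)).
    rewrite -(big_mkord xpredT (fun k => f (x + p k.+1) - f (x + p k))).
    rewrite (telescope_sumr (fun k => f (x + p k))) //.
    by rewrite p0 pn addr0 [x + h]addrC.
  rewrite /coord_form -sumrB (le_trans (ler_norm_sum _ _ _)) //.
  apply: (@le_trans _ _ (\sum_(k < n) `|h| * (e%:num / n.+1%:R))).
    apply: ler_sum => k _; rewrite pS addrA.
    have [t th|t th ->] := @mvt_line _ f (x + p k) (delta_mx 0 k) (h 0 k).
      by have [Uy _] := inU k t th; have [+ _] := Cf (delta_mx 0 k); exact.
    rewrite -mulrBr normrM ler_pM //; first exact: rV_coord_le.
    by have [] := inU k t th.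
  rewrite sumr_const card_ord -[_ *+ n]mulr_natr -mulrA mulrC ler_wpM2r //.
  rewrite -mulrA ler_piMr // mulrC ler_pdivrMr // mul1r ler_nat //.
Unshelve. all: by end_near. Qed.

(** Only the line through x in direction v matters: along it g is a curve of one real variable, for
    which derivable and differentiable agree, so the chain rule for differentials applies although g
    has just a directional derivative. *)
Lemma derive_comp V V' W (f : V' -> W) (g : V -> V') x v :
  differentiable f (g x) -> derivable g x v ->
  is_derive x v (f \o g) ('D_('D_v g x) f (g x)).
Proof.
move=> df /[dup] gd /derivable1P dg.
have gx : g (0 *: v + x) = g x by rewrite scale0r add0r.
have dg' : differentiable (fun h : R => g (h *: v + x)) 0 by exact/derivable1_diffP.
have dfg : differentiable (f \o (fun h : R => g (h *: v + x))) 0.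
  by apply: differentiable_comp => //; rewrite gx.
apply: DeriveDef; first by apply/derivable1P/derivable1_diffP.
have line (X : normedModType R) (q : V -> X) : 'D_v q x = 'D_1 (fun h : R => q (h *: v + x)) 0.
  rewrite /derive; set F := (X in lim (X @ _)); set G := (X in _ = lim (X @ _)).
  have -> // : F = G.
  by apply/funext => h; rewrite /F /G /= scale0r add0r addr0 [h%:A]mulr1.
rewrite (line _ (f \o g)) deriveE //.
rewrite -[X in 'd X 0]/(f \o (fun h : R => g (h *: v + x))) diff_comp //= ?gx //.
by rewrite [RHS]deriveE //= (line _ g) deriveE.
Qed.

Lemma derive_dir_sum n W (f : 'rV[R]_n -> W) y (w : 'rV[R]_n) :
  differentiable f y -> 'D_w f y = \sum_k w 0 k *: 'D_(delta_mx 0 k) f y.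
Proof.
move=> df; rewrite deriveE // {1}(row_sum_delta w) linear_sum; apply: eq_bigr => k _.
by rewrite linearZ /= deriveE.
Qed.

(** Induction on k with g fixed and f varying: the derivative along v is the sum of (D_v g)_i times
    (d_i f) o g, and the induction hypothesis applies to d_i f. *)
Lemma Ck_comp_fun V n k (U : set V) (U' : set 'rV[R]_n) (f : 'rV[R]_n -> R) (g : V -> 'rV[R]_n) :
  open U -> open U' -> (forall x, U x -> U' (g x)) ->
  Ck k U g -> Ck k U' f -> Ck k U (f \o g).
Proof.
move=> oU oU' gU; elim: k f => [|k IH] f Cg Cf.
  by split=> // x Ux; apply: continuous_comp; [exact: Ck_cont Cg _ Ux|exact: Ck_cont Cf _ (gU _ Ux)].
have df x : U x -> differentiable f (g x).
  move=> Ux; apply: (C1_differentiable oU' (gU _ Ux)).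
  by case: (Cf) => fc fd; split=> // v; have [? /Ck_cont ?] := fd v; split.
have [gc gd] := Cg; have [fc fd] := Cf; split.
  by move=> x Ux; apply: continuous_comp; [exact: gc|exact: fc (gU _ Ux)].
move=> v; have [gd1 gd2] := gd v; split.
  by move=> x Ux; have [] := derive_comp (df x Ux) (gd1 x Ux).
apply: (@Ck_eq _ _ _ _ _ (fun x => \sum_i ('D_v g x) 0 i * ('D_(delta_mx 0 i) f \o g) x)) => //.
  move=> x Ux; have [_ ->] := derive_comp (df x Ux) (gd1 x Ux).
  by rewrite derive_dir_sum //; exact: df.
apply: Ck_sum => // i _; apply: Ck_mul => //; first by move/Ck_mxP: gd2; exact.
by apply: IH; [exact: CkW|have [] := fd (delta_mx 0 i)].
Qed.

Lemma Ck_comp V n m p k (U : set V) (U' : set 'rV[R]_n) (f : 'rV[R]_n -> 'M[R]_(m, p))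
    (g : V -> 'rV[R]_n) :
  open U -> open U' -> (forall x, U x -> U' (g x)) ->
  Ck k U g -> Ck k U' f -> Ck k U (f \o g).
Proof.
move=> oU oU' gU Cg /Ck_mxP Cf; apply/Ck_mxP => // i j.
by apply: (@Ck_comp_fun _ _ _ _ U' (fun x => f x i j)) => //; exact: Cf.
Qed.

End Differentiability.

(** * Symmetry of second derivatives *)

Section Schwarz.
Context {R : realType}.
Implicit Types (V W : normedModType R).

Lemma addKAl (Z : zmodType) (x a b : Z) : x + a + b - x = a + b.
Proof. by rewrite -(addrA x) (addrC x) addrK. Qed.

(** The mean value theorem is used twice: along u for [f (y + s *: v) - f y], then along v for
    ['D_u f]. The left side is symmetric in u and v while the right side is not. *)
Lemma second_difference V (U : set V) (f : V -> R) (x u v : V) (s : R) :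
  Ck 2 U f ->
  (forall a b : R, `|a| <= `|s| -> `|b| <= `|s| -> U (x + a *: u + b *: v)) ->
  exists y, [/\ `|y - x| <= `|s| * (`|u| + `|v|),  U y &
    f (x + s *: u + s *: v) - f (x + s *: u) - (f (x + s *: v) - f x)
      = s * (s * 'D_v ('D_u f) y)].
Proof.
move=> [_ Cf] HU; have [d1 [_ d2]] := Cf u; have [d3 _] := d2 v.
have HU0 a : `|a| <= `|s| -> U (x + a *: u).
  by move=> ha; have := HU a 0 ha; rewrite normr0 scale0r addr0; exact.
pose F y := f (y + s *: v) - f y.
have dF t : `|t| <= `|s| -> derivable (fun y => f (y + s *: v)) (x + t *: u) u.
  by move=> ts; apply: derivable_shiftx; apply: d1; exact: HU.
have [t ts|t ts E] := @mvt_line _ _ F x u s.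
  by apply: derivableB; [exact: dF|apply: d1; exact: HU0].
have [b bs|b bs E'] := @mvt_line _ _ ('D_u f) (x + t *: u) v s.
  by apply: d3; exact: HU.
exists (x + t *: u + b *: v); split; last 1 first.
- rewrite -E' -(derive_shiftx f (x + t *: u)) -deriveB.
  + by rewrite [X in _ * X](_ : _ = 'D_u F (x + t *: u)) // -E /F addrAC.
  + exact: dF.
  + by apply: d1; exact: HU0.
- rewrite addKAl (le_trans (ler_normD _ _)) // !normrZ mulrDr.
  by rewrite lerD // ler_wpM2r.
- exact: HU.
Qed.

Lemma min_lel (a b : R) : Num.min a b <= a. Proof. by rewrite ge_min lexx. Qed.
Lemma min_ler (a b : R) : Num.min a b <= b. Proof. by rewrite ge_min lexx orbT. Qed.

(** Two points y and z are allowed because the mean value theorem yields unrelated intermediate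
    points for the two orders of differentiation. *)
Lemma eq_of_close_values V (A B : V -> R) (x : V) :
  {for x, continuous A} -> {for x, continuous B} ->
  (forall r, 0 < r -> exists y z, [/\ ball x r y, ball x r z & A y = B z]) ->
  A x = B x.
Proof.
move=> cA cB H; apply/eqP; rewrite -subr_eq0 -normr_le0; apply/ler_addgt0Pl => e e0.
rewrite addr0; have e2 : 0 < e / 2 by rewrite divr_gt0.
have /cvgrPdist_le /(_ _ e2) /nbhs_ballP[r1 /= r10 c1] := cA.
have /cvgrPdist_le /(_ _ e2) /nbhs_ballP[r2 /= r20 c2] := cB.
have r0 : 0 < Num.min r1 r2 by rewrite lt_min r10.
have [y [z [yx zx E]]] := H _ r0.
have h1 := c1 y (le_ball (min_lel _ _) yx).
have h2 := c2 z (le_ball (min_ler _ _) zx).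
have -> : A x - B x = (A x - A y) - (B x - B z) by rewrite E opprB addrA subrK.
by rewrite [e]splitr (le_trans (ler_normB _ _)) // lerD.
Qed.

(* Both second derivatives are limits of the same second difference. *)
Lemma derive_sym V (U : set V) (f : V -> R) (x u v : V) :
  open U -> U x -> Ck 2 U f -> 'D_v ('D_u f) x = 'D_u ('D_v f) x.
Proof.
move=> oU Ux Cf.
have cont w w' : {for x, continuous ('D_w ('D_w' f))}.
  by have [_ /(_ w')[_ [_ /(_ w)[_ [+ _]]]]] := Cf; exact.
apply: (@eq_of_close_values _ ('D_v ('D_u f)) ('D_u ('D_v f))) => // r' r'0.
have /nbhs_ballP[r'' /= r''0 rU] := open_nbhs_nbhs (conj oU Ux).
pose r := Num.min r' r''.
have r0 : 0 < r by rewrite lt_min r'0.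
(* The added 1 keeps N positive when u = v = 0; then s N = r / 2, so all intermediate points fall
   within r of x. *)
pose N := `|u| + `|v| + 1.
have N0 : 0 < N by rewrite /N ltr_wpDl // addr_ge0.
pose s := r / (2 * N).
have s0 : 0 < s by rewrite divr_gt0 // mulr_gt0.
have sN : s * (`|u| + `|v|) < r.
  have : s * N < r by rewrite /s invfM mulrA mulfVK ?gt_eqF // ltr_pdivrMr // ltr_pMr // ltr1n.
  by apply: le_lt_trans; rewrite ler_wpM2l ?(ltW s0) // /N lerDl.
have HB y : `|y - x| <= `|s| * (`|u| + `|v|) -> ball x r y.
  by move=> h; rewrite -ball_normE /= distrC (le_lt_trans h) // gtr0_norm.
have HU (a b : R) (w w' : V) : `|w| + `|w'| = `|u| + `|v| ->
    `|a| <= `|s| -> `|b| <= `|s| -> U (x + a *: w + b *: w').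
  move=> Ew ha hb; apply: rU; apply: (le_ball (min_ler r' r'')); apply: HB.
  rewrite addKAl (le_trans (ler_normD _ _)) // 2!normrZ -Ew mulrDr.
  by apply: lerD; apply: ler_wpM2r.
have [y [yx _ E1]] := second_difference Cf (fun a b => HU a b u v erefl).
have [z [zx _ E2]] := second_difference Cf (fun a b => HU a b v u (addrC _ _)).
rewrite [`|v| + _]addrC in zx.
exists y, z; split.
- by apply: (le_ball (min_lel r' r'')); exact: HB.
- by apply: (le_ball (min_lel r' r'')); exact: HB.
have s1 : s != 0 by rewrite gt_eqF.
apply: (mulfI s1); apply: (mulfI s1); rewrite -E1 -E2.
have -> : x + s *: v + s *: u = x + s *: u + s *: v by rewrite addrAC.
by move: (f _) (f _) (f _) (f _) => c1 c2 c3 c4; ring.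
Qed.

End Schwarz.

(** * Jacobian matrices and smooth matrix-valued maps *)

Section Jacobian.
Context {R : realType}.
Implicit Types (V : normedModType R).

Lemma Ck_entry V m p k (U : set V) (f : V -> 'M[R]_(m, p)) i j :
  open U -> Ck k U f -> Ck k U (fun x => f x i j).
Proof. by move=> oU /Ck_mxP; apply. Qed.

Lemma mx_differentiable V m p (f : V -> 'M[R]_(m, p)) x :
  (forall i j, differentiable (fun y => f y i j) x) -> differentiable f x.
Proof.
move=> df.
have -> : f = \sum_(i < m) (fun y => \sum_(j < p) (f y i j *: delta_mx i j)).
  by apply/funext => y; rewrite fct_sumE {1}(matrix_sum_delta (f y)).
apply: differentiable_sum => i.
have -> : (fun y => \sum_(j < p) (f y i j *: delta_mx i j)) =
    \sum_(j < p) (fun y => f y i j *: delta_mx i j : 'M[R]_(m, p)).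
  by apply/funext => y; rewrite fct_sumE.
by apply: differentiable_sum => j; exact: differentiableZl.
Qed.

Lemma Ck_differentiable n m p k (U : set 'rV[R]_n) (f : 'rV[R]_n -> 'M[R]_(m, p)) x :
  open U -> U x -> Ck k.+1 U f -> differentiable f x.
Proof.
move=> oU Ux /Ck_mxP Cf; apply: mx_differentiable => i j.
apply: (C1_differentiable oU Ux); have [fc fd] := Cf oU i j.
by split=> // v; have [? /Ck_cont ?] := fd v; split.
Qed.

Lemma smooth_differentiable n m p (U : set 'rV[R]_n) (f : 'rV[R]_n -> 'M[R]_(m, p)) x :
  open U -> U x -> smooth_on U f -> differentiable f x.
Proof. by move=> oU Ux /(_ 1%N); exact: Ck_differentiable. Qed.

Lemma jacobian_row n m (f : 'rV[R]_n -> 'rV[R]_m) x i :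
  differentiable f x -> row i ('J f x) = 'D_(delta_mx 0 i) f x.
Proof. by move=> df; rewrite deriveEjacobian // rowE. Qed.

Lemma jacobianE n m (f : 'rV[R]_n -> 'rV[R]_m) x i j :
  differentiable f x -> 'J f x i j = ('D_(delta_mx 0 i) f x) 0 j.
Proof. by move=> df; rewrite -jacobian_row // [RHS]mxE. Qed.

Lemma smooth_jacobian n m (U : set 'rV[R]_n) (f : 'rV[R]_n -> 'rV[R]_m) :
  open U -> smooth_on U f -> smooth_on U (fun y => 'J f y).
Proof.
move=> oU sf k; apply/Ck_mxP => // i j.
have [_ /(_ (delta_mx 0 i)) [_ Cd]] := sf k.+1.
apply: (@Ck_eq _ _ _ _ _ (fun y => ('D_(delta_mx 0 i) f y) 0 j)) => //; last first.
  exact: Ck_entry.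
by move=> y Uy; rewrite jacobianE //; exact: smooth_differentiable sf.
Qed.

Lemma row_mulmx_ext m p (A B : 'M[R]_(m, p)) : (forall v : 'rV[R]_m, v *m A = v *m B) -> A = B.
Proof. by move=> AB; apply/row_matrixP => i; rewrite !rowE. Qed.

Lemma jacobian_comp n m p (f : 'rV[R]_n -> 'rV[R]_m) (h : 'rV[R]_m -> 'rV[R]_p) x :
  differentiable f x -> differentiable h (f x) ->
  'J (h \o f) x = 'J f x *m 'J h (f x).
Proof.
move=> df dh; apply: row_mulmx_ext => v; rewrite mulmxA -deriveEjacobian; last first.
  exact: differentiable_comp.
have [_ ->] := @derive_comp _ _ _ _ h f x v dh (diff_derivable df).
by rewrite !deriveEjacobian.
Qed.

Lemma jacobian_near n m (f h : 'rV[R]_n -> 'rV[R]_m) x :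
  differentiable f x -> differentiable h x -> (\near x, f x = h x) ->
  'J f x = 'J h x.
Proof.
move=> df dh fh; apply: row_mulmx_ext => v; rewrite -[LHS]deriveEjacobian // -[RHS]deriveEjacobian //.
exact: near_eq_derive.
Qed.

Lemma jacobian_id n (x : 'rV[R]_n) : 'J id x = 1%:M.
Proof.
apply: row_mulmx_ext => v; rewrite -deriveEjacobian; last exact: ex_diff.
by rewrite derive_id mulmx1.
Qed.

Lemma smooth_cont V (W : normedModType R) (U : set V) (f : V -> W) :
  smooth_on U f -> forall x, U x -> {for x, continuous f}.
Proof. by move=> /(_ 0%N) /Ck_cont. Qed.

Lemma smooth_sub V (W : normedModType R) (U U' : set V) (f : V -> W) :
  U' `<=` U -> smooth_on U f -> smooth_on U' f.
Proof. by move=> sU sf k; exact: Ck_sub (sf k). Qed.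

Lemma smooth_eq V (W : normedModType R) (U : set V) (f h : V -> W) :
  open U -> (forall x, U x -> f x = h x) -> smooth_on U f -> smooth_on U h.
Proof. by move=> oU fh sf k; exact: Ck_eq (sf k). Qed.

Lemma smooth_comp V n m p (U : set V) (U' : set 'rV[R]_n) (f : 'rV[R]_n -> 'M[R]_(m, p))
    (g : V -> 'rV[R]_n) :
  open U -> open U' -> (forall x, U x -> U' (g x)) ->
  smooth_on U g -> smooth_on U' f -> smooth_on U (f \o g).
Proof. by move=> ? ? ? sg sf k; apply: Ck_comp (sg k) (sf k). Qed.

Lemma Ck_mulmx V m p q k (U : set V) (f : V -> 'M[R]_(m, p)) (h : V -> 'M[R]_(p, q)) :
  open U -> Ck k U f -> Ck k U h -> Ck k U (fun x => f x *m h x).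
Proof.
move=> oU sf sh; apply/Ck_mxP => // i j.
apply: (@Ck_eq _ _ _ _ _ (fun x => \sum_l f x i l * h x l j)) => //.
  by move=> x _; rewrite mxE.
by apply: Ck_sum => // l _; apply: Ck_mul => //; exact: Ck_entry.
Qed.

Lemma smooth_mulmx V m p q (U : set V) (f : V -> 'M[R]_(m, p)) (h : V -> 'M[R]_(p, q)) :
  open U -> smooth_on U f -> smooth_on U h -> smooth_on U (fun x => f x *m h x).
Proof. by move=> oU sf sh k; exact: Ck_mulmx oU (sf k) (sh k). Qed.

Lemma smooth_trmx V m p (U : set V) (f : V -> 'M[R]_(m, p)) :
  open U -> smooth_on U f -> smooth_on U (fun x => (f x)^T).
Proof.
move=> oU sf k; apply/Ck_mxP => // i j.
apply: (@Ck_eq _ _ _ _ _ (fun x => f x j i)) => //; first by move=> x _; rewrite mxE.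
exact: Ck_entry.
Qed.

Lemma smooth_scalemx V m p (U : set V) (c : V -> R) (f : V -> 'M[R]_(m, p)) :
  open U -> smooth_on U c -> smooth_on U f -> smooth_on U (fun x => c x *: f x).
Proof.
move=> oU sc sf k; apply/Ck_mxP => // i j.
apply: (@Ck_eq _ _ _ _ _ (fun x => c x * f x i j)) => //; first by move=> x _; rewrite mxE.
by apply: Ck_mul => //; exact: Ck_entry.
Qed.

Lemma smooth_add V (W : normedModType R) (U : set V) (f h : V -> W) :
  open U -> smooth_on U f -> smooth_on U h -> smooth_on U (fun x => f x + h x).
Proof. by move=> oU sf sh k; apply: Ck_add. Qed.

Lemma smooth_cst V (W : normedModType R) (U : set V) (a : W) : smooth_on U (fun=> a).
Proof. by move=> k; exact: Ck_cst. Qed.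

Lemma smooth_id V (U : set V) : smooth_on U (id : V -> V).
Proof. by move=> k; apply: (@Ck_lin _ _ _ _ _ idfun) => x; exact: cvg_id. Qed.

Lemma smooth_coord n (U : set 'rV[R]_n) j : smooth_on U (fun x : 'rV[R]_n => x 0 j).
Proof.
move=> k; apply: (@Ck_sub _ _ _ _ setT) => //.
by apply: Ck_entry; [exact: openT|exact: smooth_id].
Qed.

End Jacobian.

(** * Charts and transitions *)

Section ManifoldFacts.
Context {R : realType} (n : nat) (M : manifold R n).
Implicit Types (i j k : idx M) (x : M).

Lemma imgP i y : img i y -> dom i (par i y) /\ chart i (par i y) = y.
Proof. by move=> [x dx <-]; rewrite chartK. Qed.

Lemma img_chart i x : dom i x -> img i (chart i x).
Proof. by move=> dx; exists x. Qed.

Lemma open_par i (A : set M) : open A -> open [set y | img i y /\ A (par i y)].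
Proof.
move=> oA; rewrite openE => y [iy Ay].
have /(_ A) := @par_continuous _ _ M i y iy; move=> /(_ (open_nbhs_nbhs (conj oA Ay))) nA.
have nI : nbhs y (img i) by apply: open_nbhs_nbhs; split=> //; exact: img_open.
exact: filterI nI nA.
Qed.

Lemma open_chart i (B : set 'rV[R]_n) : open B -> open [set x | dom i x /\ B (chart i x)].
Proof.
move=> oB; rewrite openE => x [ix Bx].
have /(_ B) := @chart_continuous _ _ M i x ix; move=> /(_ (open_nbhs_nbhs (conj oB Bx))) nB.
have nI : nbhs x (dom i) by apply: open_nbhs_nbhs; split=> //; exact: dom_open.
exact: filterI nI nB.
Qed.

(** Turns the images used in the definitions into conditions on coordinates, to which [open_par]
    applies; since [par i] is arbitrary off [img i], the first conjunct has to be recorded. *)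
Lemma chart_image i (A : set M) :
  chart i @` (dom i `&` A) = [set y | img i y /\ A (par i y)].
Proof.
apply/seteqP; split=> [_ [x [dx Ax] <-]|y [iy Ay]].
  by split; [exact: img_chart|rewrite chartK].
by have [dy <-] := imgP iy; exists (par i y).
Qed.

Definition overlap i j : set 'rV[R]_n := chart i @` (dom i `&` dom j).

Lemma overlap_open i j : open (overlap i j).
Proof. by rewrite /overlap chart_image; exact/open_par/dom_open. Qed.

Lemma overlap_chart i j x : dom i x -> dom j x -> overlap i j (chart i x).
Proof. by move=> ix jx; exists x. Qed.

Lemma transition_map_smooth i j : smooth_on (overlap i j) (chart j \o par i).
Proof. exact: transition_smooth. Qed.

Lemma transition_map_diff i j x : dom i x -> dom j x ->
  differentiable (chart j \o par i) (chart i x).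
Proof.
move=> ix jx; apply: smooth_differentiable (@transition_map_smooth i j).
  exact: overlap_open.
exact: overlap_chart.
Qed.

Lemma transition_map_comp i j k x : dom i x -> dom j x -> dom k x ->
  \forall y \near chart i x, ((chart k \o par j) \o (chart j \o par i)) y = (chart k \o par i) y.
Proof.
move=> ix jx kx; apply: (open_near (@overlap_open i j) (overlap_chart ix jx)).
by move=> _ [z [iz jz] <-] /=; rewrite !chartK.
Qed.

(** The cocycle rule: [transition_map_comp] gives the equality of maps near the point only, which is
    enough for Jacobians. *)
Lemma transition_comp i j k x : dom i x -> dom j x -> dom k x ->
  transition i k x = transition i j x *m transition j k x.
Proof.
move=> ix jx kx; rewrite /transition.
have E : chart j x = (chart j \o par i) (chart i x) by rewrite /= chartK.
rewrite E -jacobian_comp; last 2 first.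
- exact: transition_map_diff.
- by rewrite -E; exact: transition_map_diff.
apply: jacobian_near; first exact: transition_map_diff.
  apply: differentiable_comp; first exact: transition_map_diff.
  by rewrite -E; exact: transition_map_diff.
by apply: filterS (transition_map_comp ix jx kx).
Qed.

Lemma transition_id i x : dom i x -> transition i i x = 1%:M.
Proof.
move=> ix; rewrite /transition -(jacobian_id (chart i x)); apply: jacobian_near.
- exact: transition_map_diff.
- exact: ex_diff.
- apply: (open_near (@overlap_open i i) (overlap_chart ix ix)).
  by move=> _ [z [iz jz] <-] /=; rewrite !chartK.
Qed.

Lemma transitionK i j x : dom i x -> dom j x ->
  transition i j x *m transition j i x = 1%:M.
Proof. by move=> ix jx; rewrite -transition_comp // transition_id. Qed.

Lemma transition_unit i j x : dom i x -> dom j x -> transition i j x \in unitmx.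
Proof. by move=> ix jx; exact: (mulmx1_unit (transitionK ix jx)).1. Qed.

Lemma smooth_transition i j :
  smooth_on (overlap i j) (fun y => transition i j (par i y)).
Proof.
apply: (@smooth_eq _ _ _ _ (fun y => 'J (chart j \o par i) y)).
- exact: overlap_open.
- by move=> _ [z [iz jz] <-]; rewrite /transition !chartK.
- by apply: smooth_jacobian; [exact: overlap_open|exact: transition_map_smooth].
Qed.

End ManifoldFacts.

(** * Cutoff functions *)

Section Bump.
Context {R : realType}.

(* This family is stable under derivation, hence consists of smooth functions. *)
Definition flat_exp (p : {poly R}) (x : R) : R :=
  if 0 < x then p.[x^-1] * expR (- x^-1) else 0.

(** For 0 < x <= 1 and t = 1/x >= 1, |p(t)| <= S t^N with S the sum of the absolute coefficients,
    while the exponential series gives t^(N+1) / (N+1)! <= e^t. Applied to ['X * p], the bound shows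
    that the difference quotient of [flat_exp p] at 0 tends to 0. *)
Lemma flat_exp_le (p : {poly R}) :
  exists2 C : R, 0 <= C & forall x, x <= 1 -> `|flat_exp p x| <= C * `|x|.
Proof.
pose S : R := \sum_(i < size p) `|p`_i|.
have S0 : 0 <= S by apply: sumr_ge0.
pose N := size p.
exists (S * N.+1`!%:R); first by rewrite mulr_ge0.
move=> x x1; rewrite /flat_exp; case: ifPn => x0; last by rewrite normr0 !mulr_ge0.
rewrite (gtr0_norm x0); set t := x^-1.
have t1 : 1 <= t by rewrite /t invf_ge1.
have t0 : 0 < t by rewrite invr_gt0.
have pt : `|p.[t]| <= S * t ^+ N.
  rewrite horner_coef /S mulr_suml (le_trans (ler_norm_sum _ _ _)) //.
  apply: ler_sum => i _; rewrite normrM ler_wpM2l // ger0_norm ?exprn_ge0 ?(ltW t0) //.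
  by rewrite ler_weXn2l // ltnW // ltn_ord.
have et : t ^+ N.+1 / N.+1`!%:R <= expR t.
  by rewrite (le_trans _ (expR_ge1Dxn N (ltW t0))) // lerDr.
have f0 : (0 : R) < N.+1`!%:R by rewrite ltr0n fact_gt0.
rewrite normrM expRN [`|_^-1|]ger0_norm ?invr_ge0 ?expR_ge0 //.
rewrite ler_pdivrMr ?expR_gt0 // (le_trans pt) // -!mulrA ler_wpM2l //.
have -> : x = t^-1 by rewrite invrK.
rewrite mulrCA ler_pdivlMl // -exprS -ler_pdivrMl // mulrC //.
Qed.

(** With t = 1/x one has dt/dx = - t^2, so p(t) e^(-t) has derivative t^2 (p(t) - p'(t)) e^(-t). *)
Definition flat_exp_deriv (p : {poly R}) : {poly R} := 'X^2 * (p - p^`()).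

Lemma is_derive_flat_exp (p : {poly R}) (x : R) :
  is_derive x 1 (flat_exp p) (flat_exp (flat_exp_deriv p) x).
Proof.
have [x0|x0|->] := ltgtP x 0.
- rewrite {2}/flat_exp ltNge (ltW x0) /=.
  have H : is_derive x 1 (cst 0 : R -> R) 0 by exact: is_derive_cst.
  apply: near_eq_is_derive H.
  near=> y; have y0 : y < 0 by near: y; exact: lt_nbhsl.
  by rewrite /flat_exp ltNge (ltW y0).
- suff G : is_derive x 1 (fun y : R => p.[y^-1] * expR (- y^-1)) (flat_exp (flat_exp_deriv p) x).
    apply: near_eq_is_derive G; near=> y.
    by have y0 : 0 < y by [near: y; exact: lt_nbhsr]; rewrite /flat_exp y0.
  have xn0 : x != 0 by rewrite gt_eqF.
  have dV : is_derive x 1 (fun y : R => y^-1) (- x ^- 2).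
    apply: DeriveDef; first by apply: derivableV.
    by rewrite deriveV // derive_id [_ *: _]mulr1.
  have dp : is_derive x 1 (fun y : R => p.[y^-1]) (p^`().[x^-1] * - x ^- 2).
    apply: DeriveDef.
      by apply/derivable1_diffP/(@differentiable_comp _ _ _ _ (fun y : R => y^-1) (horner p));
        apply/derivable1_diffP.
    rewrite -derive1E (@derive1_comp _ (fun y : R => y^-1) (horner p)) //.
    by rewrite -derivE; congr (_ * _); rewrite derive1E; have [_ ->] := dV.
  have de : is_derive x 1 (fun y : R => expR (- y^-1)) (expR (- x^-1) * x ^- 2).
    have dN : is_derive x 1 (fun y : R => - y^-1) (x ^- 2).
      by have := is_deriveN dV; rewrite opprK.
    apply: DeriveDef.
      by apply/derivable1_diffP/(@differentiable_comp _ _ _ _ (fun y : R => - y^-1) (@expR R));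
        apply/derivable1_diffP.
    rewrite -derive1E (@derive1_comp _ (fun y : R => - y^-1) (@expR R)) //.
    congr (_ * _); rewrite derive1E; last by have [_ ->] := dN.
    by have [_ ->] := is_derive_expR (- x^-1).
  have := is_deriveM dp de; set D := (X in is_derive _ _ _ X).
  suff -> : D = flat_exp (flat_exp_deriv p) x by [].
  rewrite /D /flat_exp x0 /flat_exp_deriv hornerM hornerXn hornerD hornerN exprVn.
  rewrite -[_ *: (_ / _)]/(_ * _) -[_ *: (_ * _)]/(_ * _).
  by move: p.[x^-1] p^`().[x^-1] (expR _) (x ^- 2) => a b c d; ring.
- rewrite {2}/flat_exp ltxx.
  have [C C0 hC] := flat_exp_le ('X * p).
  have D : h^-1 *: ((flat_exp p \o shift 0) (h *: 1) - flat_exp p 0) @[h --> 0^'] --> (0 : R).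
    apply/cvgrPdist_le => e e0; near=> h.
    have h0 : h != 0 by near: h; exact: nbhs_dnbhs_neq.
    rewrite /= [h *: 1]mulr1 addr0 sub0r normrN {2}/flat_exp ltxx subr0.
    have -> : h^-1 *: flat_exp p h = flat_exp ('X * p) h.
      rewrite /flat_exp; case: ifP => _; last by rewrite scaler0.
      by rewrite hornerM hornerX -mulrA.
    apply: (le_trans (hC h _)).
      by apply: ltW; near: h; apply: nbhs_dnbhs; exact: lt_nbhsl.
    (* Adding |h| to both sides replaces C, which may be 0, by the positive divisor C + 1. *)
    have -> : C * `|h| <= e = (`|h| * (C + 1) <= e + `|h|).
      by rewrite mulrDr mulr1 lerD2r mulrC.
    apply: (@le_trans _ _ e); last by rewrite lerDl.
    rewrite -ler_pdivlMr ?ltr_wpDl //; apply: ltW; near: h.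
    by apply: dnbhs0_lt; rewrite divr_gt0 // ltr_wpDl.
  by apply: DeriveDef; [apply/cvg_ex; exists 0|exact: cvg_lim].
Unshelve. all: by end_near. Qed.

(** The induction on k runs over all p at once, as each derivation replaces p by
    [flat_exp_deriv p]. *)
Lemma Ck_flat_exp (V : normedModType R) k (U : set V) (g : V -> R) p :
  open U -> Ck k U g -> Ck k U (flat_exp p \o g).
Proof.
move=> oU; have df q y : differentiable (flat_exp q) y.
  by apply/derivable1_diffP; have [] := is_derive_flat_exp q y.
have cont k' (q : {poly R}) x : Ck k' U g -> U x -> {for x, continuous (flat_exp q \o g)}.
  move=> Cg Ux; apply: continuous_comp; first exact: Ck_cont Cg _ Ux.
  exact: differentiable_continuous.
elim: k p => [|k IH] p Cg; first by split=> // x; exact: cont Cg.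
split=> [x|v]; first exact: cont Cg.
have [gc gd] := Cg; have [gd1 gd2] := gd v.
split; first by move=> x Ux; have [] := derive_comp (df p (g x)) (gd1 x Ux).
apply: (@Ck_eq _ _ _ _ _ (fun x => 'D_v g x * (flat_exp (flat_exp_deriv p) \o g) x)) => //.
  move=> x Ux; have [_ ->] := derive_comp (df p (g x)) (gd1 x Ux).
  have E : flat_exp (flat_exp_deriv p) (g x) = 'D_1 (flat_exp p) (g x).
    by have [_ ->] := is_derive_flat_exp p (g x).
  rewrite /= E; set w := 'D_v g x.
  by rewrite !deriveE //= -[w in RHS]mulr1 [RHS]linearZ.
by apply: Ck_mul => //; apply: IH; exact: CkW.
Qed.

(** The classical smooth step, 1 for s <= 1 and 0 for s >= 2. The arguments 2 - s and s - 1 add up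
    to 1, so they are never both nonpositive and the denominator is positive. *)
Definition cutoff (s : R) : R :=
  flat_exp 1 (2 - s) / (flat_exp 1 (2 - s) + flat_exp 1 (s - 1)).

Lemma flat_exp1_ge0 x : 0 <= flat_exp 1 x.
Proof. by rewrite /flat_exp; case: ifP => // _; rewrite hornerC mul1r expR_ge0. Qed.

Lemma flat_exp1_gt0 x : 0 < x -> 0 < flat_exp 1 x.
Proof. by rewrite /flat_exp => ->; rewrite hornerC mul1r expR_gt0. Qed.

Lemma flat_exp1_le0 x : x <= 0 -> flat_exp 1 x = 0.
Proof. by rewrite /flat_exp ltNge => ->. Qed.

Lemma cutoff_denom_gt0 s : 0 < flat_exp 1 (2 - s) + flat_exp 1 (s - 1).
Proof.
have [s1|s1] := ltP 1 s; first by rewrite ltr_wpDl ?flat_exp1_ge0 // flat_exp1_gt0 // subr_gt0.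
rewrite ltr_pwDl ?flat_exp1_ge0 // flat_exp1_gt0 // subr_gt0 (le_lt_trans s1) // ltr1n //.
Qed.

Lemma cutoff_ge0 s : 0 <= cutoff s.
Proof. by rewrite divr_ge0 ?flat_exp1_ge0 // ltW // cutoff_denom_gt0. Qed.

Lemma cutoff_le1 s : cutoff s <= 1.
Proof. by rewrite ler_pdivrMr ?cutoff_denom_gt0 // mul1r lerDl flat_exp1_ge0. Qed.

Lemma cutoff1 s : s <= 1 -> cutoff s = 1.
Proof.
move=> s1; rewrite /cutoff [flat_exp 1 (s - 1)]flat_exp1_le0 ?subr_le0 // addr0 divff //.
by rewrite gt_eqF // flat_exp1_gt0 // subr_gt0 (le_lt_trans s1) // ltr1n.
Qed.

Lemma cutoff0 s : 2 <= s -> cutoff s = 0.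
Proof. by move=> s2; rewrite /cutoff flat_exp1_le0 ?subr_le0 // mul0r. Qed.

Lemma Ck_cutoff (V : normedModType R) k (U : set V) (g : V -> R) :
  open U -> Ck k U g -> Ck k U (cutoff \o g).
Proof.
move=> oU Cg.
have C1 : Ck k U (fun x => flat_exp 1 (2 - g x)).
  apply: (@Ck_flat_exp _ _ _ (fun x => 2 - g x)) => //; apply: Ck_add => //; first exact: Ck_cst.
  exact: Ck_opp.
have C2 : Ck k U (fun x => flat_exp 1 (g x - 1)).
  by apply: (@Ck_flat_exp _ _ _ (fun x => g x - 1)) => //; apply: Ck_add => //; exact: Ck_cst.
apply: Ck_mul => //; apply: Ck_inv => //; last exact: Ck_add.
by move=> x _; rewrite gt_eqF // cutoff_denom_gt0.
Qed.

(* The norm of 'rV is the sup norm; sqn is the square of the Euclidean norm. *)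
Definition sqn n (v : 'rV[R]_n) : R := \sum_k v 0 k ^+ 2.

Lemma sqn_ge0 n (v : 'rV[R]_n) : 0 <= sqn v.
Proof. by apply: sumr_ge0 => k _; rewrite sqr_ge0. Qed.

Lemma sqnE n (v : 'rV[R]_n) : (v *m v^T) 0 0 = sqn v.
Proof. by rewrite mxE; apply: eq_bigr => k _; rewrite mxE expr2. Qed.

Lemma coord_le_sqn n (v : 'rV[R]_n) k : v 0 k ^+ 2 <= sqn v.
Proof. by rewrite /sqn (bigD1 k) //= lerDl sumr_ge0 // => i _; rewrite sqr_ge0. Qed.

Lemma sqn_eq0 n (v : 'rV[R]_n) : (sqn v == 0) = (v == 0).
Proof.
apply/eqP/eqP => [v0|->]; last by apply: big1 => k _; rewrite mxE expr0n.
apply/rowP => k; rewrite mxE; apply/eqP; rewrite -sqrf_eq0 eq_le sqr_ge0 andbT.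
by rewrite -v0 coord_le_sqn.
Qed.

Lemma sqnZ n (a : R) (v : 'rV[R]_n) : sqn (a *: v) = a ^+ 2 * sqn v.
Proof. by rewrite /sqn mulr_sumr; apply: eq_bigr => k _; rewrite mxE exprMn. Qed.

Lemma Ck_sqn n k (U : set 'rV[R]_n) (p : 'rV[R]_n) :
  open U -> Ck k U (fun y => sqn (y - p)).
Proof.
move=> oU; apply: Ck_sum => // i _.
apply: (@Ck_eq _ _ _ _ _ (fun y : 'rV[R]_n => (y 0 i - p 0 i) * (y 0 i - p 0 i))) => //.
  by move=> y _; rewrite !mxE expr2.
have C : Ck k U (fun y : 'rV[R]_n => y 0 i - p 0 i).
  by apply: Ck_add => //; [exact: smooth_coord|exact: Ck_cst].
exact: Ck_mul.
Qed.

Lemma sqn_continuous n : continuous (@sqn n).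
Proof.
move=> x; have := @Ck_sqn n 0 setT 0 openT => /Ck_cont /(_ x I).
by under [X in continuous_at _ X -> _]funext do rewrite subr0.
Qed.

(** Feeding the squared distance, a polynomial, to the cutoff keeps smoothness at p. The result is 1
    on the Euclidean ball of radius rho and 0 outside radius sqrt 2 rho, whence the [2 * rho ^+ 2]
    in what follows. *)
Definition bump n (p : 'rV[R]_n) (rho : R) (y : 'rV[R]_n) : R :=
  cutoff (sqn (y - p) / rho ^+ 2).

Lemma bump_smooth n (p : 'rV[R]_n) rho (U : set 'rV[R]_n) : open U -> smooth_on U (bump p rho).
Proof.
move=> oU k; apply: (@Ck_cutoff _ _ _ (fun y => sqn (y - p) / rho ^+ 2)) => //.
by apply: Ck_mul => //; [exact: Ck_sqn|exact: Ck_cst].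
Qed.

Lemma bump1 n (p : 'rV[R]_n) rho y : 0 < rho -> sqn (y - p) <= rho ^+ 2 -> bump p rho y = 1.
Proof. by move=> r0 h; rewrite /bump cutoff1 // ler_pdivrMr ?exprn_gt0 // mul1r. Qed.

Lemma bump_neq0 n (p : 'rV[R]_n) rho y : 0 < rho -> bump p rho y != 0 ->
  sqn (y - p) <= 2 * rho ^+ 2.
Proof.
move=> r0; apply: contraNT; rewrite -ltNge => h.
by rewrite /bump cutoff0 // ler_pdivlMr ?exprn_gt0 // ltW.
Qed.

Lemma sqn_sup n (v : 'rV[R]_n) (rho : R) : 0 <= rho -> sqn v <= 2 * rho ^+ 2 -> `|v| <= 2 * rho.
Proof.
move=> r0 h; apply: rV_norm_le; first by rewrite mulr_ge0.
move=> k; rewrite -(@ler_pXn2r _ 2) // ?nnegrE ?mulr_ge0 // -normrX ger0_norm ?sqr_ge0 //.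
rewrite (le_trans (coord_le_sqn _ _)) // (le_trans h) // exprMn ler_wpM2r ?sqr_ge0 //.
by rewrite expr2 ler_peMl // ler1n.
Qed.

Lemma sqn_ball_compact n (p : 'rV[R]_n) (r : R) : compact [set y | sqn (y - p) <= r].
Proof.
apply: bounded_closed_compact.
  (* A coordinate of y - p larger than 1 + |r| would have a square larger than |r|, since squaring
     increases numbers above 1. *)
  exists (`|p| + 1 + `|r|); split; first by rewrite num_real.
  move=> M hM y /= hy; apply: le_trans (ltW hM).
  rewrite -[y](subrK p) (le_trans (ler_normD _ _)) // addrC -addrA lerD2l.
  apply: rV_norm_le; first by rewrite addr_ge0.
  move=> k; rewrite leNgt; apply/negP => hk.
  have := le_trans (coord_le_sqn _ k) hy; apply/negP; rewrite -ltNge.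
  rewrite (le_lt_trans (ler_norm r)) // -real_normK ?num_real //.
  have h1 : 1 < `|(y - p) 0 k| by rewrite (le_lt_trans _ hk) // lerDl.
  rewrite (lt_trans _ (_ : `|(y - p) 0 k| < _)) //.
    by rewrite (le_lt_trans _ hk) // lerDr.
  by rewrite expr2 ltr_pMl // (lt_trans ltr01).
have -> : [set y | sqn (y - p) <= r] = (fun y => sqn (y - p)) @^-1` [set x | x <= r] by [].
apply: preimage_closed; last exact: closed_le.
by move=> y; have := @Ck_sqn n 0 setT p openT => /Ck_cont /(_ y I).
Qed.

End Bump.

(** * Integration *)

Section IteratedIntegral.
Context {R : realType}.

(* No measurability: the integral of a nonnegative function is a supremum over
   simple functions. *)
Lemma Rintegral_bound (h : R -> R) (C p a : R) :
  0 <= a -> 0 <= C -> (forall t, 0 <= h t <= C) ->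
  (forall t, h t != 0 -> `|t - p| <= a) ->
  0 <= (\int[@lebesgue_measure R]_t h t)%R <= C * (2 * a).
Proof.
move=> a0 C0 hC hsupp; pose I := `[p - a, p + a]%classic : set R.
have h0 t : (0 <= (h t)%:E)%E by rewrite lee_fin; have /andP[] := hC t.
have g0 t : (0 <= ((cst C%:E : R -> \bar R) \_ I) t)%E.
  by rewrite patchE; case: ifP.
have hg t : ((h t)%:E <= ((cst C%:E : R -> \bar R) \_ I) t)%E.
  rewrite patchE; case: ifPn => [_|]; first by rewrite lee_fin; have /andP[] := hC t.
  rewrite notin_setE => nI; rewrite lee_fin leNgt; apply/negP => ht; apply: nI.
  have := hsupp t; rewrite gt_eqF // => /(_ isT).
  by rewrite /I /= in_itv /= ler_norml lerBlDl lerBrDl addrC.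
have ub : (\int[@lebesgue_measure R]_t (h t)%:E <= (C * (2 * a))%:E)%E.
  apply: (@le_trans _ _ (\int[@lebesgue_measure R]_(t in I) (cst C%:E) t)%E).
    rewrite [leRHS]integral_mkcond !ge0_integralTE //.
    by apply: ereal_sup_le => _ [s /= hs <-]; exists s => // t; exact: le_trans (hg t).
  rewrite integral_cst //; last exact: measurable_itv.
  rewrite /= /I lebesgue_measure_itv /= lte_fin.
  case: ifP => _; last by rewrite mule0 lee_fin !mulr_ge0.
  rewrite -EFinD -EFinM lee_fin.
  by rewrite ler_wpM2l //; lra.
have lb : (0 <= \int[@lebesgue_measure R]_t (h t)%:E)%E by exact: integral_ge0.
have fi : (\int[@lebesgue_measure R]_t (h t)%:E)%E \is a fin_num.
  by rewrite ge0_fin_numE // (le_lt_trans ub) // ltry.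
by rewrite /Rintegral fine_ge0 //= -lee_fin fineK.
Qed.

Lemma integral_rV_bound n (f : 'rV[R]_n -> R) (C a : R) (p : 'rV[R]_n) :
  0 <= a -> 0 <= C -> (forall y, 0 <= f y <= C) ->
  (forall y, f y != 0 -> forall k, `|y 0 k - p 0 k| <= a) ->
  0 <= integral_rV f <= C * (2 * a) ^+ n.
Proof.
move=> a0; elim: n f C p => [|n IH] f C p C0 hC hsupp; first by rewrite /= expr0 mulr1.
rewrite exprS mulrCA mulrC /=.
pose q : 'rV[R]_n := \row_j p 0 (rshift 1 j).
(* C' is kept apart from C because the slice bound is used twice: with C for the size of the outer
   integrand, and with 0 for its support. *)
have bnd C' t : 0 <= C' -> (forall y, f (row_mx (t%:M : 'M[R]_1) y) <= C') ->
    0 <= integral_rV (fun y : 'rV[R]_n => f (row_mx (t%:M : 'M[R]_1) y)) <= C' * (2 * a) ^+ n.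
  move=> C'0 hC'; apply: (IH _ C' q) => // [y|y fy k].
    by rewrite hC' andbT; have /andP[] := hC (row_mx t%:M y).
  have := hsupp _ fy (rshift 1 k); rewrite (row_mxEr (t%:M : 'M[R]_1) y) /q mxE; exact.
apply: (@Rintegral_bound _ (C * (2 * a) ^+ n) (p 0 0)) => //.
- by rewrite mulr_ge0 // exprn_ge0 // mulr_ge0.
- by move=> t; apply: bnd => // y; have /andP[] := hC (row_mx t%:M y).
(* For t farther than a from the first coordinate of p the whole slice vanishes, so [bnd] with C' =
   0 squeezes its integral to 0. *)
- move=> t; apply: contraNT; rewrite -ltNge => ht; rewrite eq_le.
  have := bnd 0 t (lexx 0); rewrite mul0r andbC; apply=> y.
  rewrite leNgt; apply/negP => fy.
  have := hsupp (row_mx (t%:M : 'M[R]_1) y) _ (lshift n (0 : 'I_1)).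
  rewrite gt_eqF // => /(_ isT).
  rewrite (row_mxEl (t%:M : 'M[R]_1) y) mxE eqxx mulr1n.
  have -> : lshift n (0 : 'I_1) = 0 :> 'I_n.+1 by apply/val_inj.
  by rewrite leNgt ht.
Qed.

End IteratedIntegral.

Lemma sqn_sub_continuous (R : realType) n (p : 'rV[R]_n) : continuous (fun y : 'rV[R]_n => sqn (y - p)).
Proof. by move=> y; have := @Ck_sqn R n 0 setT p openT => /Ck_cont /(_ y Logic.I). Qed.

Lemma sqn_ball_open (R : realType) n (p : 'rV[R]_n) r : open [set y | sqn (y - p) < r].
Proof.
rewrite (_ : [set _ | _] = (fun y => sqn (y - p)) @^-1` [set x | x < r]) //.
apply: open_comp; last exact: open_lt.
by move=> y _; exact: sqn_sub_continuous.
Qed.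

(** Compactness in its near-covering form, for the filter of finite lists directed by inclusion:
    near x the set V x covers as soon as x is in the list, and compactness makes one list serve all
    points. *)
Lemma compact_subcover (T : topologicalType) (V : T -> set T) :
  compact [set: T] -> (forall x, open (V x)) -> (forall x, V x x) ->
  exists s : seq T, forall x, exists2 y, y \in s & V y x.
Proof.
move=> /compact_near_coveringP cT oV Vx.
pose F : set_system (seq T) :=
  filter_from setT (fun s0 : seq T => [set s : seq T | {subset s0 <= s}]).
have FF : Filter F.
  apply: filter_from_filter; first by exists [::].
  move=> s1 s2 _ _; exists (s1 ++ s2) => // s /= h.
  by split=> y ys; apply: h; rewrite mem_cat ys ?orbT.
have [|s0 _ hs] := cT _ F (fun s x => exists2 y, y \in s & V y x) FF.
  move=> x _; exists (V x, [set s : seq T | {subset [:: x] <= s}]) => /=.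
    by split; [exact: open_nbhs_nbhs|exists [:: x]].
  by move=> [z s] /= [Vz xs]; exists x => //; apply: xs; rewrite mem_head.
by exists s0 => x; have := hs s0 (fun _ h => h) x Logic.I.
Qed.

(** * Bump functions and partitions of unity on a manifold *)

Section ManifoldBump.
Context {R : realType} (n : nat) (M : manifold R n).
Implicit Types (i j : idx M) (x : M).

Lemma dom_chart_at x : dom (chart_at x) x.
Proof. by rewrite /chart_at; case: cid. Qed.

Definition disc (p : 'rV[R]_n) (rho : R) : set 'rV[R]_n :=
  [set y | sqn (y - p) <= 2 * rho ^+ 2].

Definition mbump i (p : 'rV[R]_n) (rho : R) (x : M) : R :=
  if `[< dom i x >] then bump p rho (chart i x) else 0.

Lemma mbumpE i p rho x : dom i x -> mbump i p rho x = bump p rho (chart i x).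
Proof. by move=> ix; rewrite /mbump asboolT. Qed.

Lemma mbump_ge0 i p rho x : 0 <= mbump i p rho x.
Proof. by rewrite /mbump; case: ifP => // _; exact: cutoff_ge0. Qed.

Lemma mbump_le1 i p rho x : mbump i p rho x <= 1.
Proof. by rewrite /mbump; case: ifP => // _; exact: cutoff_le1. Qed.

(** The Hausdorff axiom enters here. Closedness in M of the image of a disc is what keeps the
    support of a bump inside its chart and makes the extension by 0 smooth. *)
Lemma par_compact_closed i (K : set 'rV[R]_n) :
  compact K -> K `<=` img i -> compact (par i @` K) /\ closed (par i @` K).
Proof.
move=> cK KI; have cpK : compact (par i @` K).
  apply: continuous_compact => //; apply: continuous_in_subspaceT => y /set_mem Ky.
  exact/par_continuous/KI.
by split=> //; apply: compact_closed cpK; exact: carrier_hausdorff.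
Qed.

Lemma mbump_supp i p rho x : 0 < rho -> mbump i p rho x != 0 ->
  dom i x /\ disc p rho (chart i x).
Proof.
move=> r0; rewrite /mbump; case: asboolP => [ix|_]; last by rewrite eqxx.
by move=> /(bump_neq0 r0).
Qed.

Lemma mbump_closure i p rho : 0 < rho -> disc p rho `<=` img i ->
  closure [set x | mbump i p rho x != 0] `<=` dom i.
Proof.
move=> r0 DI; have [_ cl] := par_compact_closed (@sqn_ball_compact R n p (2 * rho ^+ 2)) DI.
apply: (@subset_trans _ (par i @` disc p rho)).
  rewrite [X in _ `<=` X]((closure_id _).1 cl); apply: closure_subset => x /(mbump_supp r0)[ix dx].
  by exists (chart i x) => //; rewrite chartK.
by move=> _ [y /DI /imgP[]] ? _ <-.
Qed.

Lemma smooth_glue (W : normedModType R) j (f : M -> W) (A B : set M) :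
  open A -> open B -> A `|` B = setT ->
  smooth_on [set y | img j y /\ A (par j y)] (f \o par j) ->
  smooth_on [set y | img j y /\ B (par j y)] (f \o par j) ->
  smooth_on (img j) (f \o par j).
Proof.
move=> oA oB AB sA sB k; apply: Ck_local => y jy.
have : (A `|` B) (par j y) by rewrite AB.
case=> h; [exists [set y | img j y /\ A (par j y)]|exists [set y | img j y /\ B (par j y)]] => //.
Qed.

(** Two open sets cover M: [dom i], where the function is [bump] after a transition map, and the
    complement of the image of the disc, where it is 0. *)
Lemma mbump_smooth i p rho : 0 < rho -> disc p rho `<=` img i ->
  smooth_function (mbump i p rho).
Proof.
move=> r0 DI j.
have [_ cl] := par_compact_closed (@sqn_ball_compact R n p (2 * rho ^+ 2)) DI.
apply: (@smooth_glue _ _ _ (dom i) (~` (par i @` disc p rho))).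
- exact: dom_open.
- exact: closed_openC.
- apply/seteqP; split=> // x _; have [|] := pselect (dom i x); first by left.
  by move=> nx; right => -[y /DI /imgP[dy _] yx]; apply: nx; rewrite -yx.
- apply: (@smooth_eq _ _ _ _ (bump p rho \o (chart i \o par j))).
  + exact/open_par/dom_open.
  + by move=> y [jy iy]; rewrite /= mbumpE.
  + move=> k; apply: (@Ck_comp_fun _ _ _ _ _ setT) => //.
    * exact/open_par/dom_open.
    * exact: openT.
    * rewrite -chart_image; exact: transition_smooth.
    * exact/bump_smooth/openT.
- apply: (@smooth_eq _ _ _ _ (fun=> 0)); last exact: smooth_cst.
    exact/open_par/closed_openC.
  move=> y [jy ny] /=; apply/eqP; rewrite eq_sym; apply: contra_notT ny => h.
  have [iy dy] := mbump_supp r0 h; exists (chart i (par j y)) => //.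
  by rewrite chartK.
Qed.

Lemma mbump1 i p rho x : 0 < rho -> dom i x -> sqn (chart i x - p) <= rho ^+ 2 ->
  mbump i p rho x = 1.
Proof. by move=> r0 ix h; rewrite mbumpE // bump1. Qed.

(** The conclusion holds for all smaller radii too, because rho is later sent to 0 with the bounds
    fixed. *)
Lemma near_disc (p : 'rV[R]_n) (P : 'rV[R]_n -> Prop) : (\forall y \near p, P y) ->
  exists2 rho, 0 < rho & forall rho' y, 0 < rho' <= rho -> sqn (y - p) <= 2 * rho' ^+ 2 -> P y.
Proof.
move=> /nbhs_ballP[e /= e0 eU].
exists (e / 4); first by rewrite divr_gt0.
move=> r y /andP[r0 re] /(sqn_sup (ltW r0)) h; apply: eU.
rewrite -ball_normE /= distrC (le_lt_trans h) //.
move: re; rewrite ler_pdivlMr // => re; lra.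
Qed.

Lemma small_disc (U : set 'rV[R]_n) p : open U -> U p ->
  exists2 rho, 0 < rho & forall rho', 0 < rho' <= rho -> disc p rho' `<=` U.
Proof.
move=> oU Up; have [rho r0 h] := near_disc (open_nbhs_nbhs (conj oU Up)).
by exists rho => // rho' h' y; exact: h h'.
Qed.

Definition disc_bump (d : idx M * 'rV[R]_n * R) : M -> R := mbump d.1.1 d.1.2 d.2.

Definition good_disc (d : idx M * 'rV[R]_n * R) : Prop :=
  0 < d.2 /\ disc d.1.2 d.2 `<=` img d.1.1.

(* The products b_k (1 - b_0) ... (1 - b_(k-1)) form a partition of unity as soon
   as every point is in some {b_k = 1}, and need no division. *)
Lemma telescope_cover (l : nat) (b : nat -> R) :
  \sum_(k < l) b k * \prod_(j < k) (1 - b j) = 1 - \prod_(j < l) (1 - b j).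
Proof.
elim: l => [|l IH]; first by rewrite !big_ord0 subrr.
rewrite !big_ord_recr /= IH; ring.
Qed.

(* Near p0 only the chart i0 contributes to an integral computed with this
   partition. *)
Lemma partition_of_unity_exists i0 (p0 : 'rV[R]_n) :
  compact [set: M] -> img i0 p0 ->
  exists l (ch : 'I_l -> idx M) (chi : 'I_l -> M -> R),
    partition_of_unity ch chi /\
    exists k0 rho0, [/\ ch k0 = i0, 0 < rho0, disc p0 rho0 `<=` img i0 &
      forall x, dom i0 x -> sqn (chart i0 x - p0) <= rho0 ^+ 2 -> chi k0 x = 1].
Proof.
move=> cM ip0.
have [rho0 r00 hr0] := small_disc (@img_open _ _ M i0) ip0.
have dat x : exists rho, 0 < rho /\ disc (chart (chart_at x) x) rho `<=` img (chart_at x).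
  have [rho r0 hr] := small_disc (@img_open _ _ M (chart_at x)) (img_chart (dom_chart_at x)).
  by exists rho; split => //; apply: hr; rewrite r0 lexx.
pose rh x := sval (cid (dat x)).
pose d x : idx M * 'rV[R]_n * R := (chart_at x, chart (chart_at x) x, rh x).
have gd x : good_disc (d x) by rewrite /d /rh; case: cid.
(* The open set around x on which the bump attached to x equals 1, not merely where it is
   positive. *)
pose V x := [set z | dom (chart_at x) z /\ sqn (chart (chart_at x) z - chart (chart_at x) x) < rh x ^+ 2].
have oV x : open (V x).
  apply: (@open_chart _ _ M (chart_at x) [set y | sqn (y - chart (chart_at x) x) < rh x ^+ 2]).
  exact: sqn_ball_open.
have V1 x z : V x z -> disc_bump (d x) z = 1.
  by move=> [dz hz]; apply: mbump1 => //; [have [] := gd x|exact: ltW].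
have Vx x : V x x.
  split; first exact: dom_chart_at.
  rewrite subrr; have -> : sqn (0 : 'rV[R]_n) = 0 by apply/eqP; rewrite sqn_eq0.
  by rewrite exprn_gt0 //; have [] := gd x.
have [D hD] := compact_subcover cM oV Vx.
pose d0 : idx M * 'rV[R]_n * R := (i0, p0, rho0).
have gd0 : good_disc d0 by split => //; apply: hr0; rewrite /= r00 lexx.
(* With d0 at the head of the list the product in chi_0 is empty, so chi_0 is the bump around p0
   itself and equals 1 near p0. *)
pose s := d0 :: [seq d x | x <- D].
have gs k : good_disc (nth d0 s k).
  have [ks|ks] := ltnP k (size s); last by rewrite nth_default.
  case: k ks => [|k] //=; rewrite ltnS size_map => ks.
  by rewrite (nth_map (par i0 p0)).
pose b k := disc_bump (nth d0 s k).
pose chi (k : 'I_(size s)) x := b k x * \prod_(j < k) (1 - b j x).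
exists (size s), (fun k => (nth d0 s k).1.1), chi; split; last first.
  exists ord0, rho0; split => //; first by have [] := gd0.
  by move=> x ix hx; rewrite /chi big_ord0 mulr1 /b /= /disc_bump mbump1.
split.
- move=> k j; have sb m : smooth_on (img j) (b m \o par j).
    by have [h1 h2] := gs m; exact: mbump_smooth.
  move=> q; apply: Ck_mul; [exact: img_open|exact: sb|].
  apply: (@Ck_prod _ _ _ _ _ _ _ (fun (m : 'I_k) y => 1 - b m (par j y))); first exact: img_open.
  move=> m _; apply: Ck_add; [exact: img_open|exact: Ck_cst|].
  by apply: Ck_opp; [exact: img_open|exact: sb].
- move=> k x; apply: mulr_ge0; first exact: mbump_ge0.
  by apply: prodr_ge0 => j _; rewrite subr_ge0; exact: mbump_le1.
- move=> k; have [h1 h2] := gs k; apply: subset_trans (mbump_closure h1 h2).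
  apply: closure_subset => x /=; apply: contra_neq => h.
  by rewrite /chi /b /disc_bump h mul0r.
- move=> x; rewrite /chi (telescope_cover _ (fun k => b k x)).
  have [y yD Vyx] := hD x.
  suff [k hk] : exists k : 'I_(size s), b k x = 1.
    by rewrite (bigD1 k) //= hk subrr mul0r subr0.
  have ki : (index y D < size D)%N by rewrite index_mem.
  have ks : ((index y D).+1 < size s)%N by rewrite /= ltnS size_map.
  exists (Ordinal ks); rewrite /b /= (nth_map y) // nth_index //.
  exact: V1.
Qed.

End ManifoldBump.

(* Unification would otherwise compare derivatives by unfolding them to limits. *)
Opaque jacobian derive.

(** * Flattening a metric near a point *)

Section MatrixSmoothness.
Context {R : realType}.
Implicit Types (V : normedModType R).

Lemma Ck_det V n k (U : set V) (A : V -> 'M[R]_n) : open U ->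
  Ck k U A -> Ck k U (fun x => \det (A x)).
Proof.
move=> oU CA; apply: Ck_sum => // s _; apply: Ck_mul => //; first exact: Ck_cst.
by apply: Ck_prod => // i _; exact: Ck_entry.
Qed.

Lemma Ck_invmx V n k (U : set V) (A : V -> 'M[R]_n) : open U ->
  (forall x, U x -> A x \in unitmx) -> Ck k U A -> Ck k U (fun x => invmx (A x)).
Proof.
move=> oU uA CA; apply: (@Ck_eq _ _ _ _ _ (fun x => (\det (A x))^-1 *: \adj (A x))) => //.
  by move=> x Ux; rewrite /invmx uA.
have Cd := Ck_det oU CA.
apply/Ck_mxP => // i j.
apply: (@Ck_eq _ _ _ _ _ (fun x => (\det (A x))^-1 * cofactor (A x) j i)) => //.
  by move=> x _; rewrite !mxE.
apply: Ck_mul => //.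
  by apply: Ck_inv => // x Ux; have := uA x Ux; rewrite unitmxE unitfE.
apply: Ck_mul => //; first exact: Ck_cst.
apply: Ck_det => //; apply/Ck_mxP => // a b.
apply: (@Ck_eq _ _ _ _ _ (fun x => A x (lift j a) (lift i b))) => //.
  by move=> x _; rewrite !mxE.
exact: Ck_entry.
Qed.

Lemma Ck_mxtrace V n k (U : set V) (A : V -> 'M[R]_n) : open U ->
  Ck k U A -> Ck k U (fun x => \tr (A x)).
Proof. by move=> oU CA; apply: Ck_sum => // i _; exact: Ck_entry. Qed.

Lemma invmx_uniq n (A B : 'M[R]_n) : A *m B = 1%:M -> invmx A = B.
Proof. by move=> AB; have [uA _] := mulmx1_unit AB; rewrite -[invmx A]mulmx1 -AB mulKmx. Qed.

Lemma posdef_unit n (A : 'M[R]_n) :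
  (forall v : 'rV[R]_n, v != 0 -> 0 < (v *m A *m v^T) 0 0) -> A \in unitmx.
Proof.
move=> pA; rewrite -row_free_unit; apply: inj_row_free => v vA.
apply/eqP; apply: contraT => /pA; by rewrite vA mul0mx mxE ltxx.
Qed.

(** In the new frame G^-1 h becomes U^T (G^-1 h) T^T, a conjugate since T^T U^T = 1; the trace of
    its square is unchanged. This is why [metric_dist] does not depend on the chart picked by
    [chart_at]. *)
Lemma trace_conj n (T U G H : 'M[R]_n) :
  U *m T = 1%:M -> T *m U = 1%:M -> G \in unitmx ->
  let Q := invmx (T *m G *m T^T) *m (T *m H *m T^T - T *m G *m T^T) in
  \tr (Q *m invmx (T *m G *m T^T) *m (T *m H *m T^T - T *m G *m T^T)) =
  \tr (invmx G *m (H - G) *m invmx G *m (H - G)).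
Proof.
move=> UT TU uG.
have -> : invmx (T *m G *m T^T) = U^T *m invmx G *m U.
  apply: invmx_uniq; rewrite !mulmxA -(mulmxA (T *m G)) -trmx_mul UT trmx1 mulmx1.
  by rewrite -(mulmxA T) mulmxV // mulmx1.
rewrite -mulmxBl -mulmxBr; move: (H - G) => h /=.
have E : U^T *m invmx G *m U *m (T *m h *m T^T) = U^T *m (invmx G *m h) *m T^T.
  by rewrite !mulmxA -(mulmxA _ U T) UT mulmx1.
rewrite -[X in \tr X]mulmxA !E.
have -> : U^T *m (invmx G *m h) *m T^T *m (U^T *m (invmx G *m h) *m T^T) =
   U^T *m (invmx G *m h *m invmx G *m h) *m T^T.
  by rewrite !mulmxA -(mulmxA _ T^T U^T) -trmx_mul UT trmx1 mulmx1.
by rewrite mxtrace_mulC mulmxA -trmx_mul UT trmx1 mul1mx.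
Qed.

End MatrixSmoothness.

Section Flatten.
Context {R : realType} (n : nat) (M : manifold R n) (g : metric M).
Implicit Types (i j : idx M) (x : M).

(* Where chi = 1, this is the pull-back of the Euclidean metric by chart i0. *)
Definition flat_mx i0 (chi : M -> R) j x : 'M[R]_n :=
  (1 - chi x) *: metric_mx g j x
  + chi x *: (transition j i0 x *m (transition j i0 x)^T).

Lemma metric_unit (g1 : metric M) j x : dom j x -> metric_mx g1 j x \in unitmx.
Proof. by move=> jx; apply: posdef_unit => v v0; exact: metric_pos. Qed.

(** Positive definite matrices form a convex set, and the pull-back term is positive definite
    because the transition is invertible on [dom i0]. Elsewhere the transition has no meaning, but
    chi vanishes there; the dichotomy [supp] records this. *)
Lemma flatten_exists i0 (chi : M -> R) :
  smooth_function chi -> (forall x, 0 <= chi x <= 1) ->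
  closure [set x | chi x != 0] `<=` dom i0 ->
  exists g' : metric M, forall j x, metric_mx g' j x = flat_mx i0 chi j x.
Proof.
move=> sc c01 clc.
have supp x : chi x = 0 \/ dom i0 x.
  have [->|cx] := eqVneq (chi x) 0; first by left.
  by right; apply: clc; exact: subset_closure.
have smth j : smooth_on (img j) (flat_mx i0 chi j \o par j).
  apply: (@smooth_glue _ _ _ _ j (flat_mx i0 chi j) (dom i0) (~` closure [set x | chi x != 0])).
  - exact: dom_open.
  - exact/closed_openC/closed_closure.
  - apply/seteqP; split=> // x _; have [|] := pselect (closure [set x | chi x != 0] x).
      by move=> /clc; left.
    by right.
  - have oU : open [set y | img j y /\ dom i0 (par j y)] by exact/open_par/dom_open.
    have sub : [set y | img j y /\ dom i0 (par j y)] `<=` img j by move=> y [].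
    have sT := @smooth_transition _ _ M j i0; rewrite /overlap chart_image in sT.
    apply: smooth_add => //; apply: smooth_scalemx => //.
    + move=> k; apply: Ck_add => //; first exact: Ck_cst.
      by apply: Ck_opp => //; apply: Ck_sub sub _; exact: sc.
    + by apply: smooth_sub sub _; exact: metric_smooth.
    + by apply: smooth_sub sub _; exact: sc.
    + apply: smooth_mulmx => //; exact: smooth_trmx.
  - apply: (@smooth_eq _ _ _ _ (metric_mx g j \o par j)).
    + exact/open_par/closed_openC/closed_closure.
    + move=> y [jy ny] /=; rewrite /flat_mx.
      have -> : chi (par j y) = 0.
        by apply/eqP; apply: contra_notT ny => h; exact: subset_closure.
      by rewrite subr0 scale1r scale0r addr0.
    + by apply: smooth_sub (@metric_smooth _ _ _ g j) => y [].
have sym j x : dom j x -> (flat_mx i0 chi j x)^T = flat_mx i0 chi j x.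
  by move=> jx; rewrite /flat_mx linearD !linearZ /= Defs.metric_sym // trmx_mul trmxK.
have pos j x (v : 'rV[R]_n) : dom j x -> v != 0 -> 0 < (v *m flat_mx i0 chi j x *m v^T) 0 0.
  move=> jx v0; rewrite /flat_mx mulmxDr mulmxDl mxE -!scalemxAr -!scalemxAl.
  have pg := metric_pos g jx v0.
  have := c01 x; case: (supp x) => [->|ix] => [_|/andP[c0 c1]].
    by rewrite subr0 scale1r scale0r [in X in _ + X]mxE addr0.
  set T := transition j i0 x; rewrite [in X in X + _]mxE [in X in _ + X]mxE.
  have -> : v *m (T *m T^T) *m v^T = (v *m T) *m (v *m T)^T by rewrite trmx_mul !mulmxA.
  have sp : 0 < sqn (v *m T).
    rewrite lt_neqAle sqn_ge0 andbT eq_sym sqn_eq0; apply: contraNneq v0 => vT.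
    by rewrite -[v]mulmx1 -(transitionK jx ix) mulmxA vT mul0mx.
  rewrite sqnE; have [->|cn0] := eqVneq (chi x) 0; first by rewrite subr0 mul1r mul0r addr0.
  rewrite ltr_wpDl //; first by rewrite mulr_ge0 ?subr_ge0 // ltW.
  by rewrite mulr_gt0 // lt_neqAle eq_sym cn0.
have change j k x : dom j x -> dom k x ->
    flat_mx i0 chi j x = transition j k x *m flat_mx i0 chi k x *m (transition j k x)^T.
  move=> jx kx; rewrite /flat_mx (metric_change g jx kx).
  case: (supp x) => [->|ix].
    move: (transition j i0 x) (transition k i0 x) (transition j k x) (metric_mx g k x) => A B C D.
    by rewrite !scale0r !addr0 subr0 !scale1r.
  rewrite (transition_comp jx kx ix).
  move: (transition j k x) (transition k i0 x) => T U.
  by rewrite mulmxDr mulmxDl -!scalemxAr -!scalemxAl trmx_mul !mulmxA.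
exists (@Defs.Metric R n M (flat_mx i0 chi) smth sym pos change); exact: (fun _ _ => erefl).
Qed.

Lemma metric_dist_chart (g1 g2 : metric M) x i : dom i x ->
  metric_dist g1 g2 x =
  let Ginv := invmx (metric_mx g1 i x) in
  let h := metric_mx g2 i x - metric_mx g1 i x in
  Num.sqrt (\tr (Ginv *m h *m Ginv *m h)).
Proof.
move=> ix; rewrite /metric_dist /=; set j := chart_at x.
have jx : dom j x by exact: dom_chart_at.
rewrite (metric_change g1 jx ix) (metric_change g2 jx ix).
by rewrite (trace_conj (metric_mx g2 i x) (transitionK ix jx) (transitionK jx ix) (metric_unit g1 ix)).
Qed.

End Flatten.

(** * The L^p distance between a metric and its flattening *)

Section FlattenNorm.
Context {R : realType} (n : nat) (M : manifold R n) (g : metric M).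
Implicit Types (i j : idx M) (x : M).

Lemma integral_rV0 (f : 'rV[R]_n -> R) : (forall y, f y = 0) -> integral_rV f = 0.
Proof.
move=> f0; have := @integral_rV_bound R n f 0 0 0 (lexx 0) (lexx 0).
rewrite mul0r -eq_le => h; apply/eqP; rewrite eq_sym; apply: h => y.
  by rewrite f0 lexx.
by rewrite f0 eqxx.
Qed.

(** In chart i0 the difference g' - g is chi (1 - G), so its norm is at most B1 whatever rho is.
    With B2 bounding the volume density and a cube of side 4 rho containing the support, the
    integral is at most B1^p B2 (4 rho)^n, and n / p = 2. *)
Lemma flatten_Lnorm i0 (p0 : 'rV[R]_n) : compact [set: M] -> img i0 p0 -> (0 < n)%N ->
  exists2 rho1, 0 < rho1 & exists C : R, forall rho, 0 < rho <= rho1 ->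
    disc p0 rho `<=` img i0 /\
    forall g' : metric M, (forall j x, metric_mx g' j x = flat_mx g i0 (mbump i0 p0 rho) j x) ->
    exists2 L, is_Lnorm g g' (n%:R / 2) L & 0 <= L <= C * rho ^+ 2.
Proof.
move=> cM ip0 n0.
have [l [ch [chi [pou [k0 [rho0 [chk0 r00 D0 chi1]]]]]]] := partition_of_unity_exists cM ip0.
pose G y := metric_mx g i0 (par i0 y).
pose D2 y := \tr (invmx (G y) *m (1%:M - G y) *m invmx (G y) *m (1%:M - G y)).
have oI := @img_open _ _ M i0.
have CG : Ck 0 (img i0) G by exact: (@metric_smooth _ _ _ g i0 0%N).
have CH : Ck 0 (img i0) (fun y => 1%:M - G y).
  apply/Ck_mxP => // a b.
  apply: (@Ck_eq _ _ _ _ _ (fun y => (1%:M : 'M[R]_n) a b + - G y a b)) => //.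
    by move=> y _; rewrite [in RHS]mxE [in X in _ = _ + X]mxE.
  exact: Ck_add oI (Ck_cst _ _ _) (Ck_opp oI (Ck_entry _ _ oI CG)).
have CI : Ck 0 (img i0) (fun y => invmx (G y)).
  by apply: Ck_invmx => // y /imgP[dy _]; exact: metric_unit.
have cD2 : {for p0, continuous D2}.
  have CM := Ck_mulmx oI (Ck_mulmx oI (Ck_mulmx oI CI CH) CI) CH.
  exact: Ck_cont (Ck_mxtrace oI CM) _ ip0.
have cdet : {for p0, continuous (fun y => \det (G y))}.
  exact: Ck_cont (Ck_det oI CG) _ ip0.
have near_le (f : 'rV[R]_n -> R) : {for p0, continuous f} -> \forall y \near p0, f y <= f p0 + 1.
  move=> /cvgrPdist_le /(_ 1 ltr01); apply: filterS => y.
  by rewrite distrC ler_norml => /andP[_]; rewrite lerBlDl.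
have [rA rA0 hA] := near_disc (near_le _ cD2).
have [rB rB0 hB] := near_disc (near_le _ cdet).
(* The 1 is the margin granted by continuity in [near_le]; the absolute values spare a discussion of
   signs under the square roots. *)
pose B1 := Num.sqrt `|D2 p0 + 1|; pose B2 := Num.sqrt `|\det (G p0) + 1|.
pose p : R := n%:R / 2.
have p_gt0 : 0 < p by rewrite divr_gt0 // ltr0n.
pose C0 : R := B1 `^ p * B2.
have C00 : 0 <= C0 by rewrite mulr_ge0 ?powR_ge0 ?sqrtr_ge0.
(* rho <= rho0 / 2 gives 2 rho^2 <= rho0^2, so the support of the flattening lies where chi_k0 = 1;
   rA and rB secure the bounds on D2 and on the determinant. *)
pose rho1 := Num.min (rho0 / 2) (Num.min rA rB).
have rho1_0 : 0 < rho1 by rewrite !lt_min rA0 rB0 divr_gt0.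
(* 16 is what remains of (4 rho)^n after the power 1/p = 2/n, namely (4 rho)^2. *)
exists rho1 => //; exists (C0 `^ p^-1 * 16) => rho /andP[rho_gt0 rho_le].
have [rle0 [rleA rleB]] : rho <= rho0 / 2 /\ rho <= rA /\ rho <= rB.
  by move: rho_le; rewrite !le_min => /and3P[].
have DI : disc p0 rho `<=` img i0.
  move=> y /= hy; apply: D0; rewrite /disc /= (le_trans hy) // ler_wpM2l //.
  by rewrite ler_pXn2r // ?nnegrE; lra.
split=> // g' hg'.
pose chr := mbump i0 p0 rho.
have dist_val x : chr x = 0 -> metric_dist g g' x = 0.
  move=> c0; rewrite /metric_dist hg' /flat_mx -/chr c0 subr0 scale1r scale0r addr0 subrr.
  by rewrite mulmx0 mxtrace0 sqrtr0.
have dist_le x : metric_dist g g' x <= B1 /\ (chr x != 0 -> dom i0 x /\ disc p0 rho (chart i0 x)).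
  have [c0|cn0] := eqVneq (chr x) 0; first by rewrite dist_val // sqrtr_ge0.
  have [ix dx] := mbump_supp rho_gt0 cn0; split => //.
  rewrite (metric_dist_chart g g' ix) /= hg' /flat_mx -/chr transition_id // trmx1 mulmx1.
  have -> : (1 - chr x) *: metric_mx g i0 x + chr x *: 1%:M - metric_mx g i0 x =
      chr x *: (1%:M - metric_mx g i0 x).
    by rewrite scalerBl scale1r scalerBr -addrA addrC addrA subrK addrC.
  rewrite -!scalemxAr -!scalemxAl !mxtraceZ.
  have EG : metric_mx g i0 x = G (chart i0 x) by rewrite /G chartK.
  rewrite EG -/(D2 _); apply: ler_wsqrtr.
  have hD : D2 (chart i0 x) <= D2 p0 + 1 by apply: (hA rho) => //; rewrite rho_gt0.
  have c0 : 0 <= chr x by exact: mbump_ge0.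
  have c1 : chr x <= 1 by exact: mbump_le1.
  have cc0 : 0 <= chr x * chr x by rewrite mulr_ge0.
  have cc1 : chr x * chr x <= 1 by rewrite mulr_ile1.
  (* A nonpositive D2 makes the product nonpositive; a positive one only decreases when multiplied
     by chi^2 <= 1. *)
  rewrite mulrA; have [Dneg|Dpos] := leP (D2 (chart i0 x)) 0.
    by rewrite (le_trans _ (normr_ge0 _)) // mulr_ge0_le0.
  rewrite (le_trans (ler_piMl (ltW Dpos) cc1)) // (le_trans hD) // ler_norm //.
have [chi_s chi_0 chi_supp chi_sum] := pou.
pose integrand k := (fun y => let x := par (ch k) y in
             chi k x * (metric_dist g g' x `^ p) * Num.sqrt (\det (metric_mx g (ch k) x)))
           \_ (img (ch k)).
have on_supp x : chr x != 0 -> chi k0 x = 1.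
  move=> cn0; have [_ /(_ cn0) [ix dx]] := dist_le x.
  apply: chi1 => //; rewrite (le_trans dx) //.
  have : rho ^+ 2 <= (rho0 / 2) ^+ 2 by rewrite ler_pXn2r // ?nnegrE; lra.
  have : 0 <= rho0 ^+ 2 by exact: sqr_ge0.
  rewrite exprMn exprVn => u1 u2; rewrite (le_trans (ler_wpM2l _ u2)) //.
  have -> : 2 * (rho0 ^+ 2 / 2 ^+ 2) = rho0 ^+ 2 / 2 by field.
  by rewrite ler_pdivrMr // ler_peMr // ler1n.
(* Where g' differs from g, chi_k0 = 1 already exhausts the sum of nonnegative terms, so the other
   chi_k vanish; elsewhere the integrand contains 0 to the power p > 0. *)
have intk k : k != k0 -> integral_rV (integrand k) = 0.
  move=> kk0; apply: integral_rV0 => y; rewrite /integrand patchE; case: ifP => // _ /=.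
  set x := par _ y; have [c0|cn0] := eqVneq (chr x) 0.
    by rewrite dist_val // powR0 ?mulr0 ?mul0r // gt_eqF.
  have ck0 := on_supp x cn0.
  have : \sum_(k < l) chi k x = 1 by exact: chi_sum.
  rewrite (bigD1 k0) //= ck0 -[X in _ = X -> _]addr0 => /addrI /eqP; rewrite psumr_eq0; last by move=> i _.
  by move=> /allP /(_ k (mem_index_enum _)); rewrite kk0 /= => /eqP ->; rewrite !mul0r.
have int0 : 0 <= integral_rV (integrand k0) <= C0 * (2 * (2 * rho)) ^+ n.
  have -> : integrand k0 = (fun y => let x := par i0 y in
      chi k0 x * (metric_dist g g' x `^ p) * Num.sqrt (\det (metric_mx g i0 x))) \_ (img i0).
    by rewrite /integrand chk0.
  apply: (@integral_rV_bound R n _ C0 (2 * rho) p0) => // [|y|y].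
  - by rewrite mulr_ge0 // ltW.
  - rewrite patchE; case: ifPn => [/set_mem iy|_]; last by rewrite lexx.
    rewrite /=; set x := par i0 y; rewrite !mulr_ge0 ?powR_ge0 ?sqrtr_ge0 //=.
    have [c0|cn0] := eqVneq (chr x) 0.
      by rewrite dist_val // powR0 ?mulr0 ?mul0r // gt_eqF.
    rewrite on_supp // mul1r; have [dle /(_ cn0) [ix dx]] := dist_le x.
    have cx : chart i0 x = y by have [] := imgP iy.
    rewrite /C0; apply: ler_pM; rewrite ?powR_ge0 ?sqrtr_ge0 //.
      apply: (ge0_ler_powR (ltW p_gt0)) => //; rewrite nnegrE ?sqrtr_ge0 //.
    apply: ler_wsqrtr; apply: le_trans (ler_norm _).
    by apply: (hB rho); [rewrite rho_gt0|rewrite -cx].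
  - rewrite patchE; case: ifPn => [/set_mem iy|_]; last by rewrite eqxx.
    rewrite /=; set x := par i0 y; have cx : chart i0 x = y by have [] := imgP iy.
    have [c0|cn0] := eqVneq (chr x) 0.
      by rewrite dist_val // powR0 ?mulr0 ?mul0r ?eqxx // gt_eqF.
    move=> _ k; have [_ /(_ cn0) [ix dx]] := dist_le x.
    have := sqn_sup (ltW rho_gt0) dx; rewrite cx; apply: le_trans.
    by have := rV_coord_le (y - p0) k; rewrite !mxE.
pose I := \sum_(k < l) integral_rV (integrand k).
have EI : I = integral_rV (integrand k0).
  by rewrite /I (bigD1 k0) //= big1 ?addr0 // => k; exact: intk.
exists (I `^ p^-1).
  by exists I => //; exists l, ch, chi; split.
rewrite powR_ge0 /= EI; have /andP[I0 Ile] := int0.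
have q0 : 0 <= p^-1 by rewrite invr_ge0 ltW.
have r40 : 0 <= 2 * (2 * rho) by rewrite !mulr_ge0 // ltW.
have C4 : 0 <= C0 * (2 * (2 * rho)) ^+ n by apply: mulr_ge0 => //; exact: exprn_ge0.
apply: (le_trans (ge0_ler_powR q0 _ _ Ile)); rewrite ?nnegrE //.
rewrite powRM ?exprn_ge0 // -mulrA ler_wpM2l ?powR_ge0 // -powR_mulrn // -powRrM.
have -> : n%:R * p^-1 = 2%:R :> R.
  by rewrite /p invf_div mulrCA divff ?mulr1 // pnatr_eq0 -lt0n.
by rewrite powR_mulrn // !exprMn; lra.
Qed.

End FlattenNorm.

(** * The round sphere *)

Section Stereographic.
Context {R : realType} (n : nat).
Implicit Types (b : bool) (x : 'rV[R]_n.+1) (y : 'rV[R]_n).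

(* Chart b is the projection from the point (pole b, 0, ..., 0). *)
Definition pole b : R := if b then 1 else -1.

Lemma pole_sq b : pole b * pole b = 1.
Proof. by case: b; rewrite /pole ?mulr1 // mulrNN mulr1. Qed.

Definition stereo b x : 'rV[R]_n :=
  \row_k ((1 - pole b * x 0 ord0)^-1 * x 0 (lift ord0 k)).

Definition stereo_inv b y : 'rV[R]_n.+1 :=
  \row_j (if unlift ord0 j is Some k then 2 / (sqn y + 1) * y 0 k
          else pole b * (sqn y - 1) / (sqn y + 1)).

Lemma stereo_inv0 b y : stereo_inv b y 0 ord0 = pole b * (sqn y - 1) / (sqn y + 1).
Proof. by rewrite mxE unlift_none. Qed.

Lemma stereo_invS b y k : stereo_inv b y 0 (lift ord0 k) = 2 / (sqn y + 1) * y 0 k.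
Proof. by rewrite mxE liftK. Qed.

Lemma sqnS x : sqn x = x 0 ord0 ^+ 2 + \sum_k x 0 (lift ord0 k) ^+ 2.
Proof. by rewrite /sqn big_ord_recl. Qed.

Lemma sqn1_gt0 y : 0 < sqn y + 1.
Proof. by rewrite ltr_wpDl // sqn_ge0. Qed.

Lemma sqn_stereo_inv b y : sqn (stereo_inv b y) = 1.
Proof.
rewrite sqnS stereo_inv0; under eq_bigr do rewrite stereo_invS exprMn.
rewrite -mulr_sumr -/(sqn y) !exprMn; have := pole_sq b; rewrite -expr2 => ->.
by have := sqn1_gt0 y => /lt0r_neq0 h; field.
Qed.

Lemma stereo_inv_pole b y : 1 - pole b * stereo_inv b y 0 ord0 = 2 / (sqn y + 1).
Proof.
rewrite stereo_inv0 !mulrA pole_sq mul1r.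
by have := sqn1_gt0 y => /lt0r_neq0 h; field.
Qed.

Lemma stereo_invK b : cancel (stereo_inv b) (stereo b).
Proof.
move=> y; apply/rowP => k; rewrite mxE stereo_inv_pole stereo_invS mulrA mulVf ?mul1r //.
by rewrite mulf_neq0 // invr_neq0 // gt_eqF // sqn1_gt0.
Qed.

Lemma pole_neq b (a : R) : (a != pole b) = (1 - pole b * a != 0).
Proof.
apply/idP/idP; apply: contra_neq => h; last by rewrite h pole_sq subrr.
by apply: (mulfI (_ : pole b != 0)); [case: b {h}; rewrite /pole ?oppr_eq0 oner_neq0|
  rewrite pole_sq; apply/eqP; rewrite eq_sym -subr_eq0 h].
Qed.

(** On the sphere the other coordinates have squared norm 1 - x_0^2, which factors as (1 + e x_0)(1
    - e x_0) with e = [pole b]; hence |stereo x|^2 = (1 + e x_0) / (1 - e x_0). *)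
Lemma stereoK b x : sqn x = 1 -> x 0 ord0 != pole b -> stereo_inv b (stereo b x) = x.
Proof.
move=> x1; rewrite pole_neq; set d := 1 - _ => d0.
have E : sqn (stereo b x) = (1 + pole b * x 0 ord0) / d.
  have -> : sqn (stereo b x) = (\sum_k x 0 (lift ord0 k) ^+ 2) / d ^+ 2.
    rewrite /sqn mulr_suml; apply: eq_bigr => k _.
    by rewrite mxE -/d exprMn exprVn mulrC.
  have -> : \sum_k x 0 (lift ord0 k) ^+ 2 = 1 - x 0 ord0 ^+ 2.
    by rewrite -x1 sqnS addrC addKr.
  have -> : 1 - x 0 ord0 ^+ 2 = (1 + pole b * x 0 ord0) * d.
    by have := pole_sq b; rewrite /d; case: b {d d0} => /= _; ring.
  by field.
have E1 : sqn (stereo b x) + 1 = 2 / d by rewrite E /d in d0 *; field.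
apply/rowP => j; rewrite mxE E1; case: unliftP => [k ->|->].
  by rewrite mxE -/d; field.
have -> : sqn (stereo b x) - 1 = 2 * pole b * x 0 ord0 / d.
  by rewrite E /d in d0 *; field.
have := pole_sq b; move: (pole b) d0 => p d0 pp.
have -> : p * (2 * p * x 0 ord0 / d) / (2 / d) = (p * p) * x 0 ord0 by field.
by rewrite pp mul1r.
Qed.

Lemma stereo_inv_smooth b (U : set 'rV[R]_n) : open U -> smooth_on U (stereo_inv b).
Proof.
move=> oU k; apply/Ck_mxP => // i j; rewrite (ord1 i).
have Cs : Ck k U (fun y : 'rV[R]_n => sqn y).
  apply: (@Ck_eq _ _ _ _ _ (fun y : 'rV[R]_n => sqn (y - 0))) => //; last exact: Ck_sqn.
  by move=> y _; rewrite subr0.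
have CV : Ck k U (fun y : 'rV[R]_n => (sqn y + 1)^-1).
  apply: Ck_inv oU _ (Ck_add oU Cs (Ck_cst _ _ _)) => y _.
  by rewrite gt_eqF // sqn1_gt0.
case: (unliftP ord0 j) => [l ->|->].
  apply: (@Ck_eq _ _ _ _ _ (fun y => 2 * (sqn y + 1)^-1 * y 0 l)) => //.
    by move=> y _; rewrite stereo_invS.
  by apply: Ck_mul oU (Ck_mul oU (Ck_cst _ _ _) CV) _; exact: smooth_coord.
apply: (@Ck_eq _ _ _ _ _ (fun y => pole b * (sqn y - 1) * (sqn y + 1)^-1)) => //.
  by move=> y _; rewrite stereo_inv0.
exact: Ck_mul oU (Ck_mul oU (Ck_cst _ _ _) (Ck_add oU Cs (Ck_cst _ _ _))) CV.
Qed.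

(** An open set of the ambient space, a hyperplane being removed, so that [smooth_on] applies to
    [stereo]; on the unit sphere only the pole is lost. *)
Definition off_pole b : set 'rV[R]_n.+1 := [set x | 1 - pole b * x 0 ord0 != 0].

Lemma off_pole_open b : open (off_pole b).
Proof.
have -> : off_pole b = (fun x : 'rV[R]_n.+1 => 1 - pole b * x 0 ord0) @^-1` [set t | t != 0] by [].
apply: open_comp => [x _|]; last exact: open_neq.
have C : Ck 0 setT (fun x : 'rV[R]_n.+1 => 1 - pole b * x 0 ord0).
  have oT : open [set: 'rV[R]_n.+1] := openT.
  apply: Ck_add oT (Ck_cst _ _ _) (Ck_opp oT (Ck_mul oT (Ck_cst _ _ _) _)).
  exact: smooth_coord.
exact: Ck_cont C x Logic.I.
Qed.

Lemma stereo_smooth b : smooth_on (off_pole b) (stereo b).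
Proof.
move=> k; have oU := @off_pole_open b; apply/Ck_mxP => // i j; rewrite (ord1 i).
apply: (@Ck_eq _ _ _ _ _ (fun x => (1 - pole b * x 0 ord0)^-1 * x 0 (lift ord0 j))) => //.
  by move=> x _; rewrite mxE.
apply: Ck_mul => //; last exact: smooth_coord.
apply: Ck_inv => //.
apply: Ck_add oU (Ck_cst _ _ _) (Ck_opp oU (Ck_mul oU (Ck_cst _ _ _) _)).
exact: smooth_coord.
Qed.

(** [stereo b] is a smooth left inverse, and by the chain rule its Jacobian is a right inverse of
    the matrix. *)
Lemma stereo_inv_immersive b y : row_free ('J (stereo_inv b) y).
Proof.
apply/row_freeP; exists ('J (stereo b) (stereo_inv b y)).
have oT : open [set: 'rV[R]_n] := openT.
have d1 : differentiable (stereo_inv b) y.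
  exact: smooth_differentiable oT Logic.I (stereo_inv_smooth b oT).
have d2 : differentiable (stereo b) (stereo_inv b y).
  apply: smooth_differentiable (@off_pole_open b) _ (@stereo_smooth b).
  by rewrite /off_pole /= stereo_inv_pole mulf_neq0 // invr_neq0 // gt_eqF // sqn1_gt0.
rewrite -jacobian_comp // -(jacobian_id y); congr ('J _ y).
by apply/funext => z /=; rewrite stereo_invK.
Qed.

End Stereographic.

(** * The unit sphere as a closed manifold *)

Section Sphere.
Context {R : realType} (n : nat).

Definition sphere_set : Type := {x : 'rV[R]_n.+1 | sqn x == 1}.
HB.instance Definition _ := Choice.on sphere_set.

Lemma sqn_delta0 : sqn (delta_mx 0 ord0 : 'rV[R]_n.+1) == 1.
Proof.
rewrite sqnS mxE !eqxx expr1n big1 ?addr0 // => k _.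
by rewrite mxE eqxx /= expr0n.
Qed.

HB.instance Definition _ :=
  isPointed.Build sphere_set (exist _ (delta_mx 0 ord0 : 'rV[R]_n.+1) sqn_delta0).

Definition sphere_inj (x : sphere_set) : 'rV[R]_n.+1 := sval x.

Local Notation sphere_space := (initial_topology sphere_inj).
HB.instance Definition _ := Pointed.on sphere_space.

Definition sphere_val : sphere_space -> 'rV[R]_n.+1 := sphere_inj.

Lemma sphere_val_continuous : continuous sphere_val.
Proof. exact: initial_continuous. Qed.

Lemma sphere_val_inj : injective sphere_val.
Proof. exact: val_inj. Qed.

Lemma sphere_valP (x : sphere_space) : sqn (sphere_val x) = 1.
Proof. exact/eqP/(svalP x). Qed.

(** Off the unit sphere the value is the default [point], the first basis vector. *)
Definition to_sphere (u : 'rV[R]_n.+1) : sphere_space := insubd (point : sphere_set) u.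

Lemma to_sphereK u : sqn u = 1 -> sphere_val (to_sphere u) = u.
Proof. by move=> u1; rewrite /sphere_val /sphere_inj /to_sphere val_insubd u1 eqxx. Qed.

Lemma nbhs_sphere (x : sphere_space) (B : set sphere_space) : nbhs x B ->
  exists U, [/\ open U, U (sphere_val x) & sphere_val @^-1` U `<=` B].
Proof. by move=> [A [[U oU <-] Ux UB]]; exists U. Qed.

Lemma sphere_cvg (T : topologicalType) (f : T -> sphere_space) (t : T) :
  {for t, continuous (sphere_val \o f)} -> {for t, continuous f}.
Proof.
move=> fc B /nbhs_sphere[U [oU Ut UB]].
have /fc nU : nbhs ((sphere_val \o f) t) U by apply: open_nbhs_nbhs.
have nU' : \forall s \near t, U (sphere_val (f s)) := nU.
by apply: filterS nU' => s Us; exact: UB.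
Qed.

(** A filter on the sphere is pushed to R^(n+1), where the unit sphere is closed and bounded; a
    cluster point there is one here because neighbourhoods are traces of ambient open sets. *)
Lemma sphere_compact : compact [set: sphere_space].
Proof.
have cK : compact [set u : 'rV[R]_n.+1 | sqn u = 1].
  apply: (@subclosed_compact _ _ [set u | sqn (u - 0) <= 1]).
  - have -> : [set u : 'rV[R]_n.+1 | sqn u = 1] = (@sqn R n.+1) @^-1` [set 1] by [].
    apply: preimage_closed; last exact: closed_eq.
    by move=> u _; exact: sqn_continuous.
  - exact: sqn_ball_compact.
  - by move=> u /= u1; rewrite subr0 u1.
move=> F PF FT; have [|u [u1 clu]] := cK (sphere_val @ F) _.
  have FT' : \forall x \near F, [set u | sqn u = 1] (sphere_val x).
    by apply: filterS FT => x _; apply: sphere_valP.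
  exact: FT'.
exists (to_sphere u); split=> // A B FA /nbhs_sphere[U [oU Uu UB]].
rewrite to_sphereK // in Uu.
have [|_ [[a Aa <-] Ua]] := clu (sphere_val @` A) U _ (open_nbhs_nbhs (conj oU Uu)).
  have FA' : \forall a \near F, (sphere_val @` A) (sphere_val a).
    by apply: filterS FA => a Aa; exists a.
  exact: FA'.
by exists a; split => //; exact: UB.
Qed.

Lemma sphere_hausdorff : hausdorff_space sphere_space.
Proof.
move=> x y xy; apply: sphere_val_inj; apply: (@norm_hausdorff _ 'rV[R]_n.+1).
move=> A B nA nB.
have [z [Az Bz]] := xy _ _ (sphere_val_continuous nA) (sphere_val_continuous nB).
by exists (sphere_val z).
Qed.

Lemma sphere_second_countable : @second_countable sphere_space.
Proof. exact: (@compact_second_countable R _ sphere_compact). Qed.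

Definition sphere_dom (b : bool) : set sphere_space := sphere_val @^-1` (@off_pole R n b).
Definition sphere_chart b : sphere_space -> 'rV[R]_n := stereo b \o sphere_val.
Definition sphere_par b : 'rV[R]_n -> sphere_space := to_sphere \o stereo_inv b.

Lemma sphere_parE b y : sphere_val (sphere_par b y) = stereo_inv b y.
Proof. by rewrite to_sphereK // sqn_stereo_inv. Qed.

Lemma sphere_par_dom b y : sphere_dom b (sphere_par b y).
Proof.
rewrite /sphere_dom /= sphere_parE /off_pole /= stereo_inv_pole mulf_neq0 // invr_neq0 //.
by rewrite gt_eqF // sqn1_gt0.
Qed.

Lemma sphere_chartK b x : sphere_dom b x -> sphere_par b (sphere_chart b x) = x.
Proof.
move=> dx; apply: sphere_val_inj; rewrite sphere_parE stereoK //; first exact: sphere_valP.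
by rewrite pole_neq.
Qed.

Lemma sphere_parK b y : sphere_chart b (sphere_par b y) = y.
Proof. by rewrite /sphere_chart /= sphere_parE stereo_invK. Qed.

Lemma sphere_dom_open b : open (sphere_dom b).
Proof. by apply: open_comp => [x _|]; [exact: sphere_val_continuous|exact: off_pole_open]. Qed.

Lemma sphere_overlap i j : sphere_chart i @` (sphere_dom i `&` sphere_dom j) =
  stereo_inv i @^-1` @off_pole R n j.
Proof.
apply/seteqP; split=> [_ [x [ix jx] <-]|y /= hy].
  rewrite /= -sphere_parE sphere_chartK //.
exists (sphere_par i y); last exact: sphere_parK.
by split; [exact: sphere_par_dom|rewrite /sphere_dom /= sphere_parE].
Qed.

Lemma sphere_img b : sphere_chart b @` sphere_dom b = setT.
Proof.
apply/seteqP; split=> // y _; exists (sphere_par b y); [exact: sphere_par_dom|exact: sphere_parK].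
Qed.

Lemma stereo_inv_continuous b : continuous (@stereo_inv R n b).
Proof.
by move=> y; have := @stereo_inv_smooth R n b setT openT => /smooth_cont /(_ y Logic.I).
Qed.

Lemma sphere_img_open b : open (sphere_chart b @` sphere_dom b).
Proof. by rewrite sphere_img; exact: openT. Qed.

Lemma sphere_chart_continuous b x : sphere_dom b x -> {for x, continuous (sphere_chart b)}.
Proof.
move=> dx; apply: continuous_comp; first exact: sphere_val_continuous.
exact: smooth_cont (@stereo_smooth R n b) _ dx.
Qed.

Lemma sphere_par_continuous b y : (sphere_chart b @` sphere_dom b) y ->
  {for y, continuous (sphere_par b)}.
Proof.
move=> _; apply: sphere_cvg.
have -> : sphere_val \o sphere_par b = stereo_inv b by apply/funext => z; exact: sphere_parE.
exact: stereo_inv_continuous.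
Qed.

Lemma sphere_cover x : exists b, sphere_dom b x.
Proof.
rewrite /sphere_dom /off_pole /=.
have [h|h] := eqVneq (1 - pole true * sphere_val x 0 ord0) 0; last by exists true.
exists false; rewrite /pole in h *; apply/eqP => h'.
have : (1 + 1 : R) = 0 by move: h h'; rewrite mul1r mulN1r => h h'; lra.
by apply/eqP; rewrite -[1 + 1]/(2%:R) pnatr_eq0.
Qed.

Lemma sphere_transition i j :
  smooth_on (sphere_chart i @` (sphere_dom i `&` sphere_dom j)) (sphere_chart j \o sphere_par i).
Proof.
rewrite sphere_overlap.
have oU : open (stereo_inv i @^-1` @off_pole R n j).
  by apply: open_comp => [x _|]; [exact: stereo_inv_continuous|exact: off_pole_open].
apply: (@smooth_eq _ _ _ _ (stereo j \o stereo_inv i)) => //.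
  by move=> y _; rewrite /sphere_chart /= sphere_parE.
apply: smooth_comp oU (@off_pole_open R n j) _ (stereo_inv_smooth i oU) (@stereo_smooth R n j).
by [].
Qed.

Definition sphere : manifold R n :=
  Manifold sphere_hausdorff sphere_second_countable sphere_dom_open sphere_img_open
    sphere_chartK sphere_chart_continuous sphere_par_continuous sphere_cover sphere_transition.

(** The interface for the rest of the proof: from here on the sphere is any closed manifold with
    such an injective immersion sigma, and its charts stay abstract. *)
Lemma sphere_exists : exists (S : manifold R n) (sigma : S -> 'rV[R]_n.+1),
  [/\ closed_manifold S, continuous sigma, injective sigma,
      range sigma = [set u | sqn u = 1]
    & forall i : idx S, smooth_on (img i) (sigma \o par i) /\
        forall y, img i y -> row_free ('J (sigma \o par i) y)].
Proof.
exists sphere, sphere_val; split.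
- by split; [exact: sphere_compact|exists (point : sphere_space)].
- exact: sphere_val_continuous.
- exact: sphere_val_inj.
- apply/seteqP; split=> [_ [x _ <-]|u u1]; first exact: sphere_valP.
  by exists (to_sphere u) => //; exact: to_sphereK.
- move=> b; have E : sphere_val \o sphere_par b = stereo_inv b.
    by apply/funext => z; exact: sphere_parE.
  split; first by rewrite E; apply: stereo_inv_smooth; exact: sphere_img_open.
  by move=> y _; rewrite E; exact: stereo_inv_immersive.
Qed.

End Sphere.

(** * The connection of a flat metric *)

Section MatrixDerivatives.
Context {R : realType}.
Implicit Types (V : normedModType R).

Lemma derive_eq_open V (W : normedModType R) (U : set V) (f h : V -> W) x v :
  open U -> U x -> (forall y, U y -> f y = h y) -> 'D_v f x = 'D_v h x.
Proof.
move=> oU Ux fh; apply: near_eq_derive.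
exact: (open_near (P := fun y => f y = h y) oU Ux fh).
Qed.

Lemma derive_entry V m p (f : V -> 'M[R]_(m, p)) x v i j : derivable f x v ->
  'D_v (fun y => f y i j) x = ('D_v f x) i j.
Proof. by move=> df; rewrite (derive_mx df) mxE. Qed.

Lemma is_derive_mx V m p (f : V -> 'M[R]_(m, p)) x v (D : 'M[R]_(m, p)) :
  (forall i j, is_derive x v (fun y => f y i j) (D i j)) -> is_derive x v f D.
Proof.
move=> h; have df : derivable f x v by apply/derivable_mxP => i j; have [] := h i j.
apply: DeriveDef => //; apply/matrixP => i j; rewrite -derive_entry //.
by have [_ ->] := h i j.
Qed.

Lemma is_derive_mulmx V m p q (f : V -> 'M[R]_(m, p)) (h : V -> 'M[R]_(p, q)) x v :
  derivable f x v -> derivable h x v ->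
  is_derive x v (fun y => f y *m h y) ('D_v f x *m h x + f x *m 'D_v h x).
Proof.
move=> df dh; apply: is_derive_mx => i j.
have E : (fun y => (f y *m h y) i j) = \sum_(l < p) (fun y => f y i l * h y l j).
  by apply/funext => y; rewrite mxE fct_sumE.
have dfe k l : derivable (fun y => f y k l) x v by move/derivable_mxP: df; exact.
have dhe k l : derivable (fun y => h y k l) x v by move/derivable_mxP: dh; exact.
have H l : is_derive x v (fun y => f y i l * h y l j)
    (f x i l * ('D_v h x) l j + h x l j * ('D_v f x) i l).
  apply: DeriveDef; first exact: (derivableM (dfe i l) (dhe l j)).
  by rewrite (deriveM (dfe i l) (dhe l j)) !derive_entry.
rewrite E; apply: DeriveDef.
  by apply: derivable_sum => l; have [] := H l.
rewrite derive_sum; last by move=> l; have [] := H l.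
rewrite 3!mxE -big_split /=; apply: eq_bigr => l _; have [_ ->] := H l.
by rewrite addrC [_ * h x l j]mulrC.
Qed.

Lemma is_derive_trmx V m p (f : V -> 'M[R]_(m, p)) x v :
  derivable f x v -> is_derive x v (fun y => (f y)^T) ('D_v f x)^T.
Proof.
move=> df; apply: is_derive_mx => i j.
have -> : (fun y => (f y)^T i j) = (fun y => f y j i) by apply/funext => y; rewrite mxE.
rewrite mxE; apply: DeriveDef; first by move/derivable_mxP: df; exact.
exact: derive_entry.
Qed.

Lemma smooth_derivable V (W : normedModType R) (U : set V) (f : V -> W) x v :
  smooth_on U f -> U x -> derivable f x v.
Proof. by move=> /(_ 1%N)[_ /(_ v)[+ _]] Ux; exact. Qed.

Lemma smooth_derive V (W : normedModType R) (U : set V) (f : V -> W) v :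
  smooth_on U f -> smooth_on U ('D_v f).
Proof. by move=> sf k; have [_ /(_ v)[_]] := sf k.+1. Qed.

Lemma row_derive_jacobian n m (U : set 'rV[R]_n) (F : 'rV[R]_n -> 'rV[R]_m) z p q :
  open U -> U z -> smooth_on U F ->
  row q ('D_p (fun y => 'J F y) z) = 'D_p ('D_(delta_mx 0 q) F) z.
Proof.
move=> oU Uz sF; apply/rowP => l; rewrite mxE.
rewrite -derive_entry; last exact: smooth_derivable (smooth_jacobian oU sF) Uz.
rewrite -derive_entry; last exact: smooth_derivable (smooth_derive _ sF) Uz.
apply: (derive_eq_open _ oU Uz) => y Uy.
by rewrite jacobianE //; exact: smooth_differentiable oU Uy sF.
Qed.

Lemma derive_sym_mx n m (U : set 'rV[R]_n) (F : 'rV[R]_n -> 'rV[R]_m) z u v :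
  open U -> U z -> smooth_on U F -> 'D_u ('D_v F) z = 'D_v ('D_u F) z.
Proof.
move=> oU Uz sF; apply/rowP => l.
have E a b : ('D_a ('D_b F) z) 0 l = 'D_a ('D_b (fun y => F y 0 l)) z.
  rewrite -derive_entry; last exact: smooth_derivable (smooth_derive _ sF) Uz.
  apply: (derive_eq_open _ oU Uz) => y Uy.
  by rewrite derive_entry //; exact: smooth_derivable sF Uy.
have Cf := Ck_entry 0 l oU (sF 2%N).
exact: (etrans (E u v) (etrans (derive_sym v u oU Uz Cf) (esym (E v u)))).
Qed.

Definition hess n m (F : 'rV[R]_n -> 'rV[R]_m) z (a b : 'I_n) : 'rV[R]_m :=
  'D_(delta_mx 0 a) ('D_(delta_mx 0 b) F) z.

Lemma hess_sym n m (U : set 'rV[R]_n) (F : 'rV[R]_n -> 'rV[R]_m) z a b :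
  open U -> U z -> smooth_on U F -> hess F z a b = hess F z b a.
Proof. by move=> oU Uz sF; exact: derive_sym_mx oU Uz sF. Qed.

Lemma hess_row n m (U : set 'rV[R]_n) (F : 'rV[R]_n -> 'rV[R]_m) z a b :
  open U -> U z -> smooth_on U F ->
  row b ('D_(delta_mx 0 a) (fun y => 'J F y) z) = hess F z a b.
Proof. by move=> oU Uz sF; exact: row_derive_jacobian oU Uz sF. Qed.

Lemma addmxE m p (A B : 'M[R]_(m, p)) i j : (A + B) i j = A i j + B i j.
Proof. by rewrite mxE. Qed.

Lemma row_mul_jacobian n m (F : 'rV[R]_n -> 'rV[R]_m) z (u : 'rV[R]_n) : differentiable F z ->
  u *m 'J F z = 'D_u F z.
Proof. by move=> dF; rewrite deriveEjacobian. Qed.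

End MatrixDerivatives.

(** * Christoffel symbols and covariant derivative of a pulled-back Euclidean metric *)

Section Pullback.
Context {R : realType} (n : nat) (M : manifold R n.+1) (g : metric M) (j : idx M).
Variables (O : set 'rV[R]_n.+1) (F : 'rV[R]_n.+1 -> 'rV[R]_n.+1).
Hypotheses (oO : open O) (sF : smooth_on O F).
Hypothesis gF : forall z, O z -> metric_mx g j (par j z) = 'J F z *m ('J F z)^T.

Lemma derive_gram z l a b : O z ->
  ('D_(delta_mx 0 l) (metric_mx g j \o par j) z) a b =
  (hess F z l a *m (row b ('J F z))^T + row a ('J F z) *m (hess F z l b)^T) 0 0.
Proof.
move=> Oz; set e := delta_mx 0 l.
have sJ := smooth_jacobian oO sF.
have dJ : derivable (fun y => 'J F y) z e by exact: smooth_derivable sJ Oz.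
have -> : 'D_e (metric_mx g j \o par j) z = 'D_e (fun y => 'J F y *m ('J F y)^T) z.
  by apply: (derive_eq_open _ oO Oz) => y Oy; exact: gF.
have dT := is_derive_trmx dJ; have [dT1 dT2] := dT.
have [_ ->] := is_derive_mulmx dJ dT1; rewrite dT2.
rewrite -!(hess_row _ _ oO Oz sF).
by rewrite [LHS]mxE [RHS]mxE; congr (_ + _); rewrite !mxE; apply: eq_bigr => k _; rewrite !mxE.
Qed.

(* With F_a = row a of JF, the symmetry of second derivatives gives
   dG p q l + dG q p l - dG l p q = 2 <d_p d_q F, F_l>. *)
Lemma christoffel_pullback z p q : O z -> 'J F z \in unitmx ->
  (\row_k christoffel g j z k p q) *m 'J F z = hess F z p q.
Proof.
move=> Oz uJ; have gz := gF Oz.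
have dG l a b := derive_gram l a b Oz.
have sym a b : hess F z a b = hess F z b a by exact: hess_sym oO Oz sF.
move: gz dG uJ; move: ('J F z) => J gz dG uJ; move: sym dG; move: (hess F z) => H sym dG.
have dotC (u v : 'rV[R]_n.+1) : (u *m v^T) 0 0 = (v *m u^T) 0 0.
  by rewrite !mxE; apply: eq_bigr => k _; rewrite !mxE mulrC.
(* Raising the index by the inverse of J J^T, which is (J^-1)^T J^-1, collapses the row of symbols
   to H J^-1 with H = [H p q]; multiplying by J gives H. *)
have -> : (\row_k christoffel g j z k p q) = (invmx (J *m J^T) *m (J *m (H p q)^T))^T.
  apply/rowP => k; rewrite [LHS]mxE [RHS]mxE [RHS]mxE /christoffel.
  rewrite mulr_sumr; apply: eq_bigr => l _; rewrite !dG.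
  rewrite [(metric_mx g j \o par j) z]gz mulrCA; congr (_ * _).
  rewrite !addmxE (sym q p) (sym l p) (sym l q).
  have -> : (J *m (H p q)^T) l 0 = (H p q *m (row l J)^T) 0 0.
    by rewrite dotC !mxE; apply: eq_bigr => k' _; rewrite !mxE.
  rewrite (dotC (row q J)) (dotC (row p J)).
  move: ((H p q *m (row l J)^T) 0 0) => c.
  by field.
have E : invmx (J *m J^T) = (invmx J)^T *m invmx J.
  apply: invmx_uniq; rewrite mulmxA -(mulmxA J) -trmx_mul mulVmx // trmx1 mulmx1.
  by rewrite mulmxV.
rewrite E !trmx_mul !trmxK -!mulmxA mulVmx // mulmx1.
by rewrite -trmx_mul mulVmx // trmx1 mulmx1.
Qed.

(** Differentiating d_b (F o f) = (d_b f) JF(f) along a gives (d_a d_b f) JF plus the sum of (d_a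
    f)_p (d_b f)_q d_p d_q F. By [christoffel_pullback] the latter is the Christoffel term of the
    covariant derivative times JF. *)
Lemma cov_deriv_pullback (S : manifold R n) (phi : S -> M) i x (U : set 'rV[R]_n) a b :
  open U -> U (chart i x) -> smooth_on U (loc phi i j) ->
  (forall y, U y -> O (loc phi i j y)) ->
  'J F (loc phi i j (chart i x)) \in unitmx ->
  cov_deriv g phi i j x a b *m 'J F (loc phi i j (chart i x)) =
  hess (F \o loc phi i j) (chart i x) a b.
Proof.
set f := loc phi i j; set y := chart i x => oU Uy sf fO uJ.
have Oz := fO y Uy; set z := f y in uJ Oz *; rewrite /hess.
have sJ := smooth_jacobian oO sF.
have dF y' : U y' -> differentiable F (f y').
  by move=> Uy'; exact: smooth_differentiable oO (fO _ Uy') sF.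
have -> : 'D_(delta_mx 0 a) ('D_(delta_mx 0 b) (F \o f)) y =
    'D_(delta_mx 0 a) (fun y' => 'D_(delta_mx 0 b) f y' *m 'J F (f y')) y.
  apply: (derive_eq_open _ oU Uy) => y' Uy'.
  have df : derivable f y' (delta_mx 0 b) by exact: smooth_derivable sf Uy'.
  by have [_ ->] := derive_comp (dF y' Uy') df; rewrite row_mul_jacobian //; exact: dF.
have d1 : derivable ('D_(delta_mx 0 b) f) y (delta_mx 0 a).
  exact: smooth_derivable (smooth_derive _ sf) Uy.
have dfa : derivable f y (delta_mx 0 a) by exact: smooth_derivable sf Uy.
have dJ : differentiable (fun z => 'J F z) (f y) by exact: smooth_differentiable oO Oz sJ.
have [d2 E2] := @derive_comp _ _ _ _ (fun z => 'J F z) f y (delta_mx 0 a) dJ dfa.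
have [_ ->] := is_derive_mulmx d1 d2.
rewrite /cov_deriv -/f -/y mulmxDl; congr (_ + _).
rewrite E2 (derive_dir_sum _ dJ) mulmx_sumr.
set u := 'D_(delta_mx 0 a) f y; set v := 'D_(delta_mx 0 b) f y.
have -> : (\row_k \sum_p \sum_q christoffel g j (f y) k p q * u 0 p * v 0 q) =
    \sum_p \sum_q (u 0 p * v 0 q) *: (\row_k christoffel g j (f y) k p q).
  apply/rowP => k; rewrite mxE summxE; apply: eq_bigr => p _.
  by rewrite summxE; apply: eq_bigr => q _; rewrite !mxE -mulrA mulrC.
rewrite mulmx_suml; apply: eq_bigr => p _; rewrite -scalemxAr mulmx_suml.
rewrite {2}(row_sum_delta v) mulmx_suml scaler_sumr; apply: eq_bigr => q _.
rewrite -!scalemxAl scalerA -rowE (hess_row _ _ oO Oz sF).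
by rewrite christoffel_pullback.
Qed.

End Pullback.

(** * Spheres in a flat ball *)

Lemma derive_lt0_near (R : realType) (V : normedModType R) (f : V -> R) (z e : V) :
  derivable f z e -> 'D_e f z < 0 -> \forall t \near 0^'+, f (z + t *: e) < f z.
Proof.
move=> df D0.
move/cvgrPdist_lt : (df) => /(_ (- 'D_e f z / 2)).
rewrite divr_gt0 ?oppr_gt0 // => /(_ isT) H.
have H' : \forall t \near 0^'+, `|'D_e f z - t^-1 *: ((f \o shift z) (t *: e) - f z)| < - 'D_e f z / 2.
  by move: H; rewrite !near_withinE; apply: filterS => t h t0; apply: h; rewrite gt_eqF.
near=> t.
have t0 : 0 < t by near: t; exact: nbhs_right_gt.
have : `|'D_e f z - t^-1 *: ((f \o shift z) (t *: e) - f z)| < - 'D_e f z / 2 by near: t; exact: H'.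
rewrite /= addrC ltr_norml => /andP[h _].
have : t^-1 * (f (z + t *: e) - f z) < 0.
  rewrite -[_ * _]/(t^-1 *: _); rewrite [t *: e + z]addrC in h; lra.
by rewrite pmulr_rlt0 ?invr_gt0 // subr_lt0.
Unshelve. all: by end_near. Qed.

Lemma near_right_open (R : realType) (V : normedModType R) (O : set V) (z e : V) :
  open O -> O z -> \forall t \near 0^'+, O (z + t *: e).
Proof.
move=> oO Oz.
have c : (fun t : R => z + t *: e) @ (0 : R) --> z.
  rewrite -[X in _ --> X](addr0 z); apply: cvgD; first exact: cvg_cst.
  by rewrite -(scale0r e); apply: cvgZr_tmp; exact: cvg_id.
have /c n0 : nbhs z O by apply: open_nbhs_nbhs.
have n1 : \forall t \near (0 : R), O (z + t *: e) := n0.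
by rewrite near_withinE; apply: filterS n1.
Qed.

Lemma row_free_mulr (R : realType) m n p (A : 'M[R]_(m, n)) (B : 'M[R]_(n, p)) :
  row_free A -> row_free B -> row_free (A *m B).
Proof.
move=> /row_freeP[A' AA] /row_freeP[B' BB]; apply/row_freeP; exists (B' *m A').
by rewrite mulmxA -(mulmxA A) BB mulmx1.
Qed.

(** T stands for the transition from i0 to a chart j and U for its inverse: U U^T is the flat metric
    in chart j, A T a tangent frame, N a normal. Products for the flat metric thus become Euclidean
    products in i0. *)
Lemma pull_orth (R : realType) m p (A : 'M[R]_(m, p)) (T U : 'M[R]_p) (N s : 'rV[R]_p) :
  T *m U = 1%:M -> N *m U = - s ->
  A *m T *m (U *m U^T) *m N^T = - (A *m s^T).
Proof.
move=> TU NU; rewrite mulmxA -(mulmxA A) TU mulmx1 -mulmxA -trmx_mul NU.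
by rewrite linearN /= mulmxN.
Qed.

Lemma row_dotC (R : realType) p (u v : 'rV[R]_p) : (u *m v^T) 0 0 = (v *m u^T) 0 0.
Proof. by rewrite !mxE; apply: eq_bigr => k _; rewrite !mxE mulrC. Qed.

Lemma gram_entry (R : realType) m p (A : 'M[R]_(m, p)) a b :
  (row a A *m (row b A)^T) 0 0 = (A *m A^T) b a.
Proof. by rewrite !mxE; apply: eq_bigr => k _; rewrite !mxE mulrC. Qed.

Lemma add_rows0 (R : realType) p (A B C D : 'rV[R]_p) :
  A *m B^T + C *m D^T = 0 -> (A *m B^T) 0 0 = - (D *m C^T) 0 0.
Proof.
move=> /(congr1 (fun X : 'M[R]_1 => X 0 0)); rewrite addmxE [X in _ = X -> _]mxE.
by rewrite (row_dotC C) => /eqP; rewrite addr_eq0 => /eqP.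
Qed.

Lemma scalemxE (R : realType) m p (a : R) (A : 'M[R]_(m, p)) i j : (a *: A) i j = a * A i j.
Proof. by rewrite mxE. Qed.

Lemma oppmxE (R : realType) m p (A : 'M[R]_(m, p)) i j : (- A) i j = - A i j.
Proof. by rewrite mxE. Qed.

Lemma gram_conj (R : realType) m p (A : 'M[R]_(m, p)) (T U : 'M[R]_p) : T *m U = 1%:M ->
  A *m T *m (U *m U^T) *m (A *m T)^T = A *m A^T.
Proof.
move=> TU; rewrite mulmxA -(mulmxA A) TU mulmx1 trmx_mul -mulmxA (mulmxA U^T).
by rewrite -trmx_mul TU trmx1 mul1mx.
Qed.

Lemma gram_scale (R : realType) m p (r : R) (A : 'M[R]_(m, p)) :
  (r *: A) *m (r *: A)^T = r ^+ 2 *: (A *m A^T).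
Proof. by rewrite linearZ /= -scalemxAr -scalemxAl scalerA expr2. Qed.

Lemma mul_gram (R : realType) p (r : R) (c N H s : 'rV[R]_p) (T : 'M[R]_p) :
  c *m T = r *: H -> N *m T = - s ->
  (c *m (T *m T^T) *m N^T) 0 0 = r * - (H *m s^T) 0 0.
Proof.
move=> cT NT; rewrite mulmxA cT -mulmxA -trmx_mul NT linearN /= mulmxN oppmxE.
by rewrite -scalemxAl scalemxE mulrN.
Qed.

(** The first fundamental form is r^2 A A^T and the second one r A A^T, so the shape operator is 1/r
    times the identity. *)
Lemma trace_shape (R : realType) m p (r : R) (A : 'M[R]_(m, p)) : 0 < r -> row_free A ->
  \sum_a \sum_b invmx (r ^+ 2 *: (A *m A^T)) a b * (r * (A *m A^T) b a) = m%:R / r.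
Proof.
move=> r0 fA; set h := A *m A^T.
have u0 : h \in unitmx.
  apply: posdef_unit => v v0; rewrite /h mulmxA -mulmxA -trmx_mul sqnE.
  rewrite lt_neqAle sqn_ge0 andbT eq_sym sqn_eq0; apply: contraNneq v0 => vA.
  by apply/eqP; apply: (row_free_inj fA); rewrite vA mul0mx.
have ur : r ^+ 2 *: h \in unitmx.
  by rewrite -mul_scalar_mx unitmx_mul u0 andbT unitmxE det_scalar unitrX // unitfE expf_neq0 // gt_eqF.
transitivity (r^-1 * \tr (invmx (r ^+ 2 *: h) *m (r ^+ 2 *: h))); last first.
  by rewrite mulVmx // mxtrace1 mulrC.
rewrite mulr_sumr; apply: eq_bigr => a _; rewrite mxE mulr_sumr; apply: eq_bigr => b _.
rewrite scalemxE [RHS]mulrCA; congr (_ * _).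
by rewrite expr2 -!mulrA mulKf // gt_eqF.
Qed.

Section FlatSphere.
Context {R : realType} (n : nat) (M : manifold R n.+1) (g : metric M) (i0 : idx M).
Variables (S : manifold R n) (sigma : S -> 'rV[R]_n.+1).
Hypotheses (S_closed : closed_manifold S) (sigma_cont : continuous sigma)
  (sigma_inj : injective sigma) (sigma_range : range sigma = [set u | sqn u = 1]).
Hypothesis sigma_smooth : forall i : idx S, smooth_on (img i) (sigma \o par i).
Hypothesis sigma_imm : forall (i : idx S) y, img i y -> row_free ('J (sigma \o par i) y).
Variables (W : set 'rV[R]_n.+1) (q : 'rV[R]_n.+1) (r : R).
Hypotheses (oW : open W) (WI : W `<=` img i0) (r0 : 0 < r).
Hypothesis ballW : forall y, sqn (y - q) <= r ^+ 2 -> W y.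
Hypothesis flat : forall j x, dom i0 x -> dom j x -> W (chart i0 x) ->
  metric_mx g j x = transition j i0 x *m (transition j i0 x)^T.

Definition round_ball : set M := [set x | dom i0 x /\ sqn (chart i0 x - q) < r ^+ 2].
Definition sphere_map (x : S) : M := par i0 (q + r *: sigma x).
(** In chart i0 this is - sigma, the Euclidean inward normal, of length 1 whatever r; the transition
    expresses it in chart j. *)
Definition sphere_normal (j : idx M) (x : S) : 'rV[R]_n.+1 :=
  - (sigma x *m transition i0 j (sphere_map x)).

Lemma sqn_sigma x : sqn (sigma x) = 1.
Proof. by have : range sigma (sigma x) by [exists x]; rewrite sigma_range. Qed.

Lemma sqn_sphere_point x : sqn (q + r *: sigma x - q) = r ^+ 2.
Proof. by rewrite addrC addKr sqnZ sqn_sigma mulr1. Qed.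

Lemma sphere_point_W x : W (q + r *: sigma x).
Proof. by apply: ballW; rewrite sqn_sphere_point. Qed.

Lemma sphere_map_dom x : dom i0 (sphere_map x).
Proof. by have [] := imgP (WI (sphere_point_W x)). Qed.

Lemma chart_sphere_map x : chart i0 (sphere_map x) = q + r *: sigma x.
Proof. by have [] := imgP (WI (sphere_point_W x)). Qed.

Lemma sphere_map_inj : injective sphere_map.
Proof.
move=> x y xy; apply: sigma_inj; apply: (scalerI (lt0r_neq0 r0)).
by apply: (addrI q); rewrite -!chart_sphere_map xy.
Qed.

Lemma sphere_point_continuous : continuous (fun x => q + r *: sigma x).
Proof.
move=> x; apply: cvgD; first exact: cvg_cst.
by apply: cvgZl_tmp; exact: sigma_cont.
Qed.

Lemma sphere_map_continuous : continuous sphere_map.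
Proof.
move=> x; apply: (@continuous_comp _ _ _ (fun x => q + r *: sigma x) (par i0)).
  exact: sphere_point_continuous.
exact: par_continuous (WI (sphere_point_W x)).
Qed.

(** A continuous injection of a compact space into a Hausdorff space is closed onto its image: the
    open set sought is the complement of the image of the complement of V. *)
Lemma sphere_map_embedded p : embedded_at sphere_map p.
Proof.
exists setT; split=> //; first exact: openT.
split; first by move=> x y _ _; exact: sphere_map_inj.
move=> V oV; exists (~` (sphere_map @` (~` V))).
  apply: closed_openC; apply: compact_closed; first exact: carrier_hausdorff.
  apply: continuous_compact; first by apply: continuous_subspaceT; exact: sphere_map_continuous.
  by have [cS _] := S_closed; apply: (subclosed_compact _ cS) => //; exact: open_closedC.
apply/seteqP; split=> [_ [x [_ Vx] <-]|_ [[x _ <-] h]].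
  split; first by exists x.
  by move=> [y nVy /sphere_map_inj yx]; apply: nVy; rewrite yx.
exists x => //; split => //; apply: contrapT => nVx; apply: h; by exists x.
Qed.

(** The immersion read in chart i0, but written without [par i0], so that its derivatives are those
    of sigma up to the factor r. *)
Definition flat_sphere (i : idx S) : 'rV[R]_n -> 'rV[R]_n.+1 := fun y => q + r *: sigma (par i y).

Lemma flat_sphere_smooth i : smooth_on (img i) (flat_sphere i).
Proof.
have oI := @img_open _ _ S i.
apply: smooth_add => //; first exact: smooth_cst.
apply: smooth_scalemx => //; exact: smooth_cst.
Qed.

Definition sphere_overlap_img (i : idx S) (j : idx M) : set 'rV[R]_n :=
  [set y | img i y /\ dom j (sphere_map (par i y))].

Lemma sphere_overlap_img_open i j : open (sphere_overlap_img i j).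
Proof.
apply: (@open_par _ _ S i (sphere_map @^-1` dom j)).
by apply: open_comp => [x _|]; [exact: sphere_map_continuous|exact: dom_open].
Qed.

Lemma sphere_overlap_img_sub i j : sphere_overlap_img i j `<=` img i.
Proof. by move=> y []. Qed.

Lemma sphere_overlap_img_overlap i j y : sphere_overlap_img i j y -> overlap i0 j (flat_sphere i y).
Proof.
move=> [iy jy]; exists (sphere_map (par i y)); last by rewrite chart_sphere_map.
by split; [exact: sphere_map_dom|].
Qed.

Lemma loc_sphere i j : loc sphere_map i j = (chart j \o par i0) \o flat_sphere i.
Proof. by []. Qed.

Lemma loc_smooth i j : smooth_on (sphere_overlap_img i j) (loc sphere_map i j).
Proof.
rewrite loc_sphere; apply: smooth_comp (@sphere_overlap_img_open i j) (@overlap_open _ _ M i0 j) _ _ _.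
- by move=> y; exact: sphere_overlap_img_overlap.
- exact: smooth_sub (@sphere_overlap_img_sub i j) (@flat_sphere_smooth i).
- exact: transition_map_smooth.
Qed.

Lemma sphere_overlap_img_chart i j x : dom i x -> dom j (sphere_map x) -> sphere_overlap_img i j (chart i x).
Proof. by move=> ix jx; split; [exact: img_chart|rewrite chartK]. Qed.

Lemma flat_sphere_chart i x : dom i x -> flat_sphere i (chart i x) = chart i0 (sphere_map x).
Proof. by move=> ix; rewrite chart_sphere_map /flat_sphere chartK. Qed.

Lemma flat_sphere_diff i y : img i y -> differentiable (flat_sphere i) y.
Proof. by move=> iy; exact: smooth_differentiable (@img_open _ _ S i) iy (@flat_sphere_smooth i). Qed.

Lemma sigma_par_diff i y : img i y -> differentiable (sigma \o par i) y.
Proof. by move=> iy; exact: smooth_differentiable (@img_open _ _ S i) iy (@sigma_smooth i). Qed.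

Lemma is_derive_flat_sphere i y v : img i y ->
  is_derive y v (flat_sphere i) (r *: 'D_v (sigma \o par i) y).
Proof.
move=> iy; have ds : derivable (sigma \o par i) y v by exact: diff_derivable (sigma_par_diff iy).
have H := is_deriveZ r (derivableP ds).
have := is_deriveD (is_derive_cst q y v) H.
by rewrite add0r.
Qed.

Lemma jacobian_flat_sphere i y : img i y -> 'J (flat_sphere i) y = r *: 'J (sigma \o par i) y.
Proof.
move=> iy; apply: row_mulmx_ext => v; rewrite -scalemxAr.
rewrite [LHS](row_mul_jacobian v (flat_sphere_diff iy)) (row_mul_jacobian v (sigma_par_diff iy)).
by have [_ ->] := is_derive_flat_sphere v iy.
Qed.

Lemma jacobian_flat_sphere_free i y : img i y -> row_free ('J (flat_sphere i) y).
Proof.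
move=> iy; rewrite jacobian_flat_sphere // -mul_scalar_mx; apply: row_free_mulr; last exact: sigma_imm.
rewrite row_free_unit unitmxE det_scalar unitrX // unitfE gt_eqF //.
Qed.

Lemma jacobian_loc i j x : dom i x -> dom j (sphere_map x) ->
  'J (loc sphere_map i j) (chart i x) =
  'J (flat_sphere i) (chart i x) *m transition i0 j (sphere_map x).
Proof.
move=> ix jx; have iy := img_chart ix; rewrite loc_sphere jacobian_comp.
- by rewrite flat_sphere_chart.
- exact: flat_sphere_diff.
- by rewrite flat_sphere_chart //; apply: transition_map_diff => //; exact: sphere_map_dom.
Qed.

Lemma sphere_map_almost_embedded : almost_embedded sphere_map.
Proof.
split; last by move=> p _ /(_ (sphere_map_embedded p)).
split; first split.
- exact: sphere_map_continuous.
- by move=> i j; rewrite chart_image; exact: loc_smooth.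
- move=> x i j ix jx; rewrite jacobian_loc //; apply: row_free_mulr.
    exact/jacobian_flat_sphere_free/img_chart.
  by rewrite row_free_unit; apply: transition_unit => //; exact: sphere_map_dom.
Qed.

Lemma normal_back j x : dom j (sphere_map x) ->
  sphere_normal j x *m transition j i0 (sphere_map x) = - sigma x.
Proof.
move=> jx; rewrite /sphere_normal mulNmx -mulmxA transitionK ?mulmx1 //.
exact: sphere_map_dom.
Qed.

(** Differentiate the constant function <sigma, sigma> = 1. *)
Lemma sigma_tangent i y v : img i y ->
  'D_v (sigma \o par i) y *m (sigma (par i y))^T = 0.
Proof.
move=> iy; have oI := @img_open _ _ S i.
have ds : derivable (sigma \o par i) y v by exact: diff_derivable (sigma_par_diff iy).
have [dT1 dT2] := is_derive_trmx ds.
have [_ E] := is_derive_mulmx ds dT1.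
have E0 : 'D_v (fun y => (sigma \o par i) y *m ((sigma \o par i) y)^T) y = 0.
  rewrite (@derive_eq_open _ _ _ (img i) _ (fun=> 1%:M) _ _ oI iy); first by rewrite derive_cst.
  move=> z _; apply/matrixP => a b; rewrite !ord1 sqnE /= sqn_sigma mxE eqxx //.
rewrite E dT2 in E0; apply/matrixP => a b; rewrite !ord1 [RHS]mxE.
have := congr1 (fun A : 'M[R]_1 => A 0 0) E0; rewrite /= addmxE [X in _ = X -> _]mxE.
have -> : (sigma (par i y) *m ('D_v (sigma \o par i) y)^T) 0 0 =
    ('D_v (sigma \o par i) y *m (sigma (par i y))^T) 0 0.
  by rewrite !mxE; apply: eq_bigr => k _; rewrite !mxE mulrC.
by move=> h; lra.
Qed.

Lemma flat_at j x : dom j (sphere_map x) ->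
  metric_mx g j (sphere_map x) =
  transition j i0 (sphere_map x) *m (transition j i0 (sphere_map x))^T.
Proof.
move=> jx; apply: flat => //; first exact: sphere_map_dom.
by rewrite chart_sphere_map; exact: sphere_point_W.
Qed.

Lemma sphere_normal_field : unit_normal_field g sphere_map sphere_normal.
Proof.
split.
- move=> j k x jx kx; rewrite /sphere_normal mulNmx -mulmxA -transition_comp //.
  exact: sphere_map_dom.
- move=> i j; rewrite chart_image.
  have oP := @sphere_overlap_img_open i j.
  apply: (@smooth_eq _ _ _ _ (fun y => (-1) *: ((sigma \o par i) y *m
     ((fun z => transition i0 j (par i0 z)) \o flat_sphere i) y))) => //.
    by move=> y _; rewrite scaleN1r.
  apply: smooth_scalemx => //; first exact: smooth_cst.
  apply: smooth_mulmx => //; first exact: smooth_sub (@sphere_overlap_img_sub i j) (@sigma_smooth i).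
  apply: smooth_comp oP (@overlap_open _ _ M i0 j) _ _ _.
  + by move=> y; exact: sphere_overlap_img_overlap.
  + exact: smooth_sub (@sphere_overlap_img_sub i j) (@flat_sphere_smooth i).
  + exact: smooth_transition.
- move=> j x jx; rewrite flat_at // mulmxA normal_back // -mulmxA -trmx_mul normal_back //.
  by rewrite linearN /= mulmxN mulNmx opprK sqnE sqn_sigma.
- move=> i j x ix jx; rewrite flat_at // jacobian_loc //.
  rewrite (pull_orth _ (transitionK (sphere_map_dom x) jx) (normal_back jx)).
  apply/eqP; rewrite oppr_eq0; apply/eqP.
  have iy := img_chart ix; rewrite jacobian_flat_sphere //.
  apply/row_matrixP => a; rewrite row0 rowE mulmxA -scalemxAr.
  rewrite (row_mul_jacobian _ (sigma_par_diff iy)) -scalemxAl.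
  by rewrite -[x in sigma x](chartK ix) sigma_tangent // scaler0.
Qed.

(** Its sign decides on which side of the sphere a coordinate ray of chart j starts: - 2 r along the
    normal, 2 r along its opposite. *)
Lemma radius_derive j x e : dom j (sphere_map x) ->
  is_derive (chart j (sphere_map x)) e
    (fun y => sqn ((chart i0 \o par j) y - q))
    (2 * r * (sigma x *m (e *m transition j i0 (sphere_map x))^T) 0 0).
Proof.
move=> jx; set z := chart j (sphere_map x); set F := chart i0 \o par j.
have ix := sphere_map_dom x.
have dF : differentiable F z by exact: transition_map_diff.
have Fz : F z = q + r *: sigma x by rewrite /F /z /= chartK // chart_sphere_map.
have dFe : derivable (fun y => F y - q) z e.
  by apply: derivableB; [exact: diff_derivable|exact: derivable_cst].
have DF : 'D_e (fun y => F y - q) z = e *m transition j i0 (sphere_map x).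
  rewrite (deriveB (diff_derivable dF) (derivable_cst _ _ _)) derive_cst subr0.
  by rewrite deriveEjacobian.
have [dT1 dT2] := is_derive_trmx dFe.
have [d3 E] := is_derive_mulmx dFe dT1.
have -> : (fun y => sqn (F y - q)) = (fun y => ((F y - q) *m (F y - q)^T) 0 0).
  by apply/funext => y; rewrite sqnE.
apply: DeriveDef; first by move/derivable_mxP: d3; exact.
rewrite (derive_entry 0 0 d3) E dT2 DF Fz [q + _]addrC addrK.
set u := r *: _; set v := e *m _; rewrite addmxE.
have -> : (v *m u^T) 0 0 = (u *m v^T) 0 0.
  by rewrite !mxE; apply: eq_bigr => k _; rewrite !mxE mulrC.
by rewrite /u -scalemxAl scalemxE -mulrA mulr_natl mulr2n.
Qed.

Lemma sphere_inward : inward_unit_normal g sphere_map round_ball sphere_normal.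
Proof.
split; first exact: sphere_normal_field.
move=> j x jx; set z := chart j (sphere_map x).
have ix := sphere_map_dom x.
pose f y := sqn ((chart i0 \o par j) y - q).
have fz : f z = r ^+ 2 by rewrite /f /z /= chartK // chart_sphere_map sqn_sphere_point.
have zO : overlap j i0 z by exact: overlap_chart.
have val e : e *m transition j i0 (sphere_map x) = - sigma x ->
    is_derive z e f (- (2 * r)).
  move=> He; have := radius_derive e jx; rewrite He linearN /= mulmxN.
  by rewrite oppmxE sqnE sqn_sigma mulrN mulr1.
have dom_near e : \forall t \near 0^'+, overlap j i0 (z + t *: e).
  exact: near_right_open (@overlap_open _ _ M j i0) zO.
have inball y : overlap j i0 y -> f y < r ^+ 2 -> round_ball (par j y).
  by rewrite /overlap chart_image => -[jy iy] fy; split.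
have [d1 D1] := val _ (normal_back jx).
split.
  have h1 := derive_lt0_near d1.
  rewrite D1 oppr_lt0 mulr_gt0 // fz in h1; have h2 := dom_near (sphere_normal j x).
  near=> t; apply: inball; first by near: t; exact: h2.
  by near: t; exact: h1.
(* The sphere never touches itself, so the opposite ray really leaves the ball. *)
left.
(* Changing the sign of f lets [derive_lt0_near] also show that the squared distance grows along the
   opposite ray. *)
pose f' y := - f y.
have : is_derive z (- sphere_normal j x) f' (- (2 * r)).
  have := radius_derive (- sphere_normal j x) jx.
  have -> : - sphere_normal j x *m transition j i0 (sphere_map x) = sigma x.
    by rewrite mulNmx normal_back // [LHS]opprK.
  rewrite sqnE sqn_sigma mulr1 => h.
  exact: is_deriveN h.
move=> [d2 D2]; have h1 := derive_lt0_near d2; rewrite D2 oppr_lt0 mulr_gt0 // in h1.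
have h3 := h1 isT.
near=> t; move=> [_ ht].
have : f' (z + t *: (- sphere_normal j x)) < f' z by near: t; exact: h3.
rewrite /f' ltrN2 fz scalerN; rewrite /f /= => h.
by have := lt_trans h ht; rewrite ltxx.
Unshelve. all: by end_near. Qed.

Lemma round_ball_open : open round_ball.
Proof. exact: (@open_chart _ _ M i0 [set y | sqn (y - q) < r ^+ 2] (@sqn_ball_open _ _ q (r ^+ 2))). Qed.

Lemma range_sphere_map : range sphere_map = boundary round_ball.
Proof.
have cB : compact [set y | sqn (y - q) <= r ^+ 2] by exact: sqn_ball_compact.
have BI : [set y | sqn (y - q) <= r ^+ 2] `<=` img i0 by move=> y /ballW /WI.
have [_ cl] := par_compact_closed cB BI.
have clos : closure round_ball `<=` par i0 @` [set y | sqn (y - q) <= r ^+ 2].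
  rewrite [X in _ `<=` X]((closure_id _).1 cl); apply: closure_subset => x [ix hx].
  by exists (chart i0 x); [exact: ltW|rewrite chartK].
have int : interior round_ball = round_ball by apply/interior_id; exact: round_ball_open.
rewrite /boundary int; apply/seteqP; split=> [_ [x _ <-]|p [/clos[y /= hy <-] nb]].
  split; last first.
    by move=> [_]; rewrite chart_sphere_map sqn_sphere_point ltxx.
  move=> B nB; have ix := sphere_map_dom x.
  (* Points of the ball arbitrarily close to a point of the sphere are found by following the inward
     normal in chart i0. *)
  have [_ /(_ i0 x ix) [h1 _]] := sphere_inward.
  have par_c := @par_continuous _ _ M i0 _ (img_chart ix).
  rewrite /prop_for /continuous_at chartK // in par_c.
  have : nbhs (chart i0 (sphere_map x)) (par i0 @^-1` B) := par_c B nB.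
  rewrite nbhsE => -[B' [oB Bz] BB].
  have h2 := @near_right_open _ _ B' _ (sphere_normal i0 x) oB Bz.
  have [t [t1 t2]] := @filter_ex _ _ _ _ (filterI h1 h2).
  by exists (par i0 (chart i0 (sphere_map x) + t *: sphere_normal i0 x)); split => //; exact: BB.
have [iy cy] := imgP (BI y hy).
have ey : sqn (y - q) = r ^+ 2.
  apply/eqP; rewrite eq_le hy leNgt; apply/negP => h; apply: nb; split => //.
  by rewrite cy.
have : range sigma (r^-1 *: (y - q)).
  by rewrite sigma_range /= sqnZ ey exprVn mulVf // expf_eq0 gt_eqF.
move=> [x _ sx]; exists x => //; rewrite /sphere_map sx scalerA divff ?gt_eqF // scale1r.
by rewrite addrC subrK.
Qed.

Lemma hess_flat_sphere i y a b : img i y ->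
  hess (flat_sphere i) y a b = r *: hess (sigma \o par i) y a b.
Proof.
move=> iy; have oI := @img_open _ _ S i; rewrite /hess.
rewrite (@derive_eq_open _ _ _ (img i) _ (fun y => r *: 'D_(delta_mx 0 b) (sigma \o par i) y) _ _ oI iy); last first.
  by move=> z iz; have [_ ->] := is_derive_flat_sphere (delta_mx 0 b) iz.
have d : derivable ('D_(delta_mx 0 b) (sigma \o par i)) y (delta_mx 0 a).
  exact: smooth_derivable (smooth_derive _ (@sigma_smooth i)) iy.
exact: (deriveZ r d).
Qed.

(** Differentiate the tangency relation <d_b sigma, sigma> = 0 along a. *)
Lemma hess_sphere_normal i y a b : img i y ->
  (hess (sigma \o par i) y a b *m (sigma (par i y))^T) 0 0 =
  - (row a ('J (sigma \o par i) y) *m (row b ('J (sigma \o par i) y))^T) 0 0.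
Proof.
move=> iy; have oI := @img_open _ _ S i.
rewrite !jacobian_row; try exact: sigma_par_diff.
set s := sigma \o par i; set ea := delta_mx 0 a; set eb := delta_mx 0 b.
have d1 : derivable ('D_eb s) y ea.
  exact: smooth_derivable (smooth_derive _ (@sigma_smooth i)) iy.
have ds : derivable s y ea by exact: diff_derivable (sigma_par_diff iy).
have [dT1 dT2] := is_derive_trmx ds.
have [_ E] := is_derive_mulmx d1 dT1.
have E0 : 'D_ea (fun y => 'D_eb s y *m (s y)^T) y = 0.
  rewrite (@derive_eq_open _ _ _ (img i) _ (fun=> 0) _ _ oI iy); first by rewrite derive_cst.
  by move=> z iz; rewrite sigma_tangent.
by rewrite E dT2 in E0; exact: (add_rows0 E0).
Qed.

Lemma sphere_gram i j x : dom i x -> dom j (sphere_map x) ->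
  'J (loc sphere_map i j) (chart i x) *m metric_mx g j (sphere_map x)
    *m ('J (loc sphere_map i j) (chart i x))^T =
  r ^+ 2 *: ('J (sigma \o par i) (chart i x) *m ('J (sigma \o par i) (chart i x))^T).
Proof.
move=> ix jx; rewrite (flat_at jx) (jacobian_loc ix jx).
by rewrite (gram_conj _ (transitionK (sphere_map_dom x) jx)) (jacobian_flat_sphere (img_chart ix)) gram_scale.
Qed.

Lemma sphere_cov i j x a b : dom i x -> dom j (sphere_map x) ->
  cov_deriv g sphere_map i j x a b *m transition j i0 (sphere_map x) =
  r *: hess (sigma \o par i) (chart i x) a b.
Proof.
move=> ix jx; have iy := img_chart ix; have jz := sphere_map_dom x.
pose F := chart i0 \o par j.
(* The part of chart j that lies over W: there the metric is the pull-back of the Euclidean one by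
   the transition map F, and F composed with the immersion is [flat_sphere]. *)
pose O := [set z | img j z /\ [set p | dom i0 p /\ W (chart i0 p)] (par j z)].
have oO : open O by apply: open_par; exact: open_chart.
have OS : O `<=` overlap j i0 by rewrite /overlap chart_image => z [? []].
have sF : smooth_on O F by exact: smooth_sub OS (@transition_map_smooth _ _ M j i0).
have gF z : O z -> metric_mx g j (par j z) = 'J F z *m ('J F z)^T.
  move=> [zj [zi zW]]; have [dz cz] := imgP zj.
  rewrite (flat zi dz zW); have -> // : transition j i0 (par j z) = 'J F z.
  by rewrite /transition cz.
have UO y : sphere_overlap_img i j y -> O (loc sphere_map i j y).
  move=> [yi yj]; split; first by exists (sphere_map (par i y)).
  rewrite /= chartK //; split; first exact: sphere_map_dom.
  by rewrite chart_sphere_map; exact: sphere_point_W.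
have Ez : loc sphere_map i j (chart i x) = chart j (sphere_map x) by rewrite /loc /= chartK.
have JT : 'J F (loc sphere_map i j (chart i x)) = transition j i0 (sphere_map x) by rewrite Ez.
rewrite -JT (cov_deriv_pullback oO sF gF _ _ (@sphere_overlap_img_open i j)
  (sphere_overlap_img_chart ix jx) (@loc_smooth i j) UO); last first.
  by rewrite JT; exact: transition_unit.
rewrite -(hess_flat_sphere a b iy) /hess.
have oU := @sphere_overlap_img_open i j.
have Uy := sphere_overlap_img_chart ix jx.
apply: (derive_eq_open _ oU Uy) => y Uy1; apply: (derive_eq_open _ oU Uy1) => y' [yi yj].
have E1 : F (chart j (sphere_map (par i y'))) = chart i0 (sphere_map (par i y')).
  by rewrite /F /= (chartK yj).
exact: etrans E1 (chart_sphere_map _).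
Qed.

Lemma sphere_second_form i j x a b : dom i x -> dom j (sphere_map x) ->
  (cov_deriv g sphere_map i j x a b *m metric_mx g j (sphere_map x) *m (sphere_normal j x)^T) 0 0
  = r * ('J (sigma \o par i) (chart i x) *m ('J (sigma \o par i) (chart i x))^T) b a.
Proof.
move=> ix jx; rewrite (flat_at jx) (mul_gram (sphere_cov a b ix jx) (normal_back jx)).
have := hess_sphere_normal a b (img_chart ix); rewrite (chartK ix) => ->.
by rewrite gram_entry opprK.
Qed.

Lemma sphere_map_cmc : has_cmc g sphere_map (n%:R / r) sphere_normal.
Proof.
move=> i j x ix jx; rewrite /mean_curvature (sphere_gram ix jx).
under eq_bigr do under eq_bigr do rewrite (sphere_second_form _ _ ix jx).
have fr := sigma_imm (img_chart ix); move: ('J _ _) fr => A fr.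
exact: trace_shape.
Qed.

Lemma round_ball_Ptilde : Ptilde g (n%:R / r) round_ball.
Proof.
split; first exact: round_ball_open.
exists S, sphere_map, sphere_normal; split => //.
- exact: sphere_map_almost_embedded.
- exact: range_sphere_map.
- exact: sphere_inward.
- exact: sphere_map_cmc.
Qed.

End FlatSphere.

(** * Counting balls in the flat disc, and conclusion *)

Lemma sqn0 (R : realType) n : sqn (0 : 'rV[R]_n) = 0.
Proof. by apply/eqP; rewrite sqn_eq0. Qed.

Lemma sqnD_le (R : realType) n (u v : 'rV[R]_n) : sqn (u + v) <= 2 * sqn u + 2 * sqn v.
Proof.
rewrite /sqn !mulr_sumr -big_split /=; apply: ler_sum => k _; rewrite mxE.
have := sqr_ge0 (u 0 k - v 0 k); move: (u 0 k) (v 0 k) => a b; nra.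
Qed.

(** The centres lie on a segment with spacing r. Neighbouring balls overlap, yet no ball contains
    the centre of another one, so the m + 1 sets are distinct. *)
Lemma flat_disc_balls (R : realType) n (M : manifold R n.+1) (g g' : metric M) i0
    (p0 : 'rV[R]_n.+1) (rho : R) m :
  0 < rho -> disc p0 rho `<=` img i0 ->
  (forall j x, metric_mx g' j x = flat_mx g i0 (mbump i0 p0 rho) j x) ->
  card_ge (Ptilde g' (n%:R / (rho / (2 * m.+1%:R)))) (m.+1%:R : R).
Proof.
move=> rho0 DI hg'; set r := rho / _.
have m0 : (0 : R) < m.+1%:R by [].
have r0 : 0 < r by rewrite divr_gt0 // mulr_gt0.
pose e : 'rV[R]_n.+1 := delta_mx 0 ord0.
have e1 : sqn e = 1 by apply/eqP; exact: sqn_delta0.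
pose q (k : nat) := p0 + (k%:R * r) *: e.
pose W : set 'rV[R]_n.+1 := [set y | sqn (y - p0) < rho ^+ 2].
have WD : W `<=` disc p0 rho.
  by move=> y /ltW h; rewrite /disc /= (le_trans h) // ler_peMl ?sqr_ge0 // ler1n.
have qW k y : (k < m.+1)%N -> sqn (y - q k) <= r ^+ 2 -> W y.
  move=> km hy; rewrite /W /=.
  have -> : y - p0 = (y - q k) + (k%:R * r) *: e by rewrite /q opprD addrA subrK.
  (* The bound is 2 r^2 + 2 (k r)^2 with k <= m, which is less than 4 (m + 1)^2 r^2 = rho^2; this is
     what the 2 in the definition of r pays for. *)
  apply: le_lt_trans (sqnD_le _ _) _; rewrite sqnZ e1 mulr1.
  have kle : k%:R <= m%:R :> R by rewrite ler_nat -ltnS.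
  have k0 : 0 <= k%:R :> R by [].
  have -> : rho = 2 * m.+1%:R * r by rewrite /r mulrC divfK // mulf_neq0 // gt_eqF.
  rewrite -(natr1 m); move: kle hy k0 r0; move: (sqn _) (k%:R) (m%:R) => s a b ab sr a0 r_gt0.
  have AB : a * r <= b * r by rewrite ler_wpM2r // ltW.
  have A0 : 0 <= a * r by rewrite mulr_ge0 // ltW.
  have A2 : (a * r) ^+ 2 <= (b * r) ^+ 2 by rewrite ler_pXn2r // nnegrE (le_trans A0).
  have Br : 0 <= b * r * r by apply: mulr_ge0; [exact: le_trans AB|exact: ltW].
  have r2 : 0 < r ^+ 2 by rewrite exprn_gt0.
  have -> : (2 * (b + 1) * r) ^+ 2 = 4 * (b * r) ^+ 2 + 8 * (b * r * r) + 4 * r ^+ 2 by ring.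
  have B2 : 0 <= (b * r) ^+ 2 by exact: sqr_ge0.
  by move: (b * r * r) (r ^+ 2) ((b * r) ^+ 2) ((a * r) ^+ 2) sr Br r2 A2 B2 => *; lra.
have Pk k : (k < m.+1)%N -> Ptilde g' (n%:R / r) (round_ball i0 (q k) r).
  move=> km; have [S [sigma [clS cs inj_s rs hs]]] := @sphere_exists R n.
  apply: (@round_ball_Ptilde R n M g' i0 S sigma clS cs inj_s rs
    (fun i => (hs i).1) (fun i => (hs i).2) W (q k) r).
  - exact: sqn_ball_open.
  - exact: subset_trans WD DI.
  - by [].
  - by move=> y; exact: qW km.
  - move=> j x ix jx Wx; rewrite hg' /flat_mx mbump1 //; last exact: ltW.
    move: (metric_mx g j x) (transition j i0 x) => A T.
    by rewrite subrr scale0r scale1r add0r.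
exists m.+1 => //.
apply: (@card_le_trans _ _ _ ((fun k => round_ball i0 (q k) r) @` `I_m.+1)); last first.
  by apply: subset_card_le => _ [k km <-]; exact: Pk.
suff /card_esym : ((fun k => round_ball i0 (q k) r) @` `I_m.+1 #= `I_m.+1)%card.
  by rewrite card_eq_le => /andP[].
(* If the balls k and l coincide, the centre of the first lies in the second, so ((k - l) r)^2 <
   r^2, which forces k = l for integers. *)
apply: inj_card_eq => k l /set_mem km /set_mem lm kl.
have Wq : W (q k) by apply: (qW k) => //; rewrite subrr sqn0 sqr_ge0.
have [dk ck] := imgP (DI _ (WD _ Wq)).
have : round_ball i0 (q k) r (par i0 (q k)).
  by split => //; rewrite ck subrr sqn0 exprn_gt0.
rewrite [round_ball _ _ _]kl => -[_]; rewrite ck /q opprD addrACA subrr add0r -scalerBl sqnZ e1 mulr1.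
rewrite -mulrBl exprMn gtr_pMl ?exprn_gt0 // => h.
apply/eqP; apply: contraTT h => kl'; rewrite -leNgt.
have : 1 <= `|k%:R - l%:R : R|.
  wlog lk : k l {km lm kl Wq dk ck} kl' / (l < k)%N => [hw|].
    move: kl'; rewrite neq_ltn => /orP[h|h]; last by apply: hw => //; rewrite gtn_eqF.
    by rewrite distrC; apply: hw => //; rewrite gtn_eqF.
  by rewrite -natrB ?(ltnW lk) // ger0_norm // ler1n subn_gt0.
by move=> h; rewrite -real_normK ?num_real // exprn_ege1.
Qed.

Theorem corollary1p4 (R : realType) (n : nat) (hn : (3 <= n.+1 <= 7)%N)
    (M : manifold R n.+1) (hM : closed_manifold M) (g : metric M) :
  exists (gs : nat -> metric M) (c N : nat -> R),
    [/\ forall i, 0 < c i /\ 0 < N i,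
        c i @[i --> \oo] --> +oo,
        N i @[i --> \oo] --> +oo,
        Lcvg (n.+1%:R / 2) gs g
      & forall i, card_ge (Ptilde (gs i) (c i)) (N i)].
Proof.
have [cM [x0 _]] := hM.
have n0 : (0 < n)%N by case/andP: hn; rewrite ltnS => /ltnW.
have ip0 := img_chart (dom_chart_at x0).
set i0 := chart_at x0 in ip0; set p0 := chart i0 x0 in ip0.
have [rho1 rho10 [C HC]] := flatten_Lnorm g cM ip0 (ltn0Sn n).
(* Any null sequence bounded by rho1 would give the convergence of metrics; this one is explicit,
   and the radii become rho1 / (2 (i + 1)^2). *)
pose rho i : R := rho1 * i.+1%:R^-1.
have rho_gt0 i : 0 < rho i by rewrite mulr_gt0 ?invr_gt0.
have rho_le i : 0 < rho i <= rho1.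
  by rewrite rho_gt0 /= ler_piMr ?(ltW rho10) // invf_le1 // ler1n.
have ex i : exists g' : metric M,
    forall j x, metric_mx g' j x = flat_mx g i0 (mbump i0 p0 (rho i)) j x.
  have [DI _] := HC _ (rho_le i); apply: flatten_exists.
  - exact: mbump_smooth.
  - by move=> x; rewrite mbump_ge0 mbump_le1.
  - exact: mbump_closure.
have [gs hgs] := choice ex.
pose r i : R := rho i / (2 * i.+1%:R).
have r_gt0 i : 0 < r i by rewrite divr_gt0 ?mulr_gt0.
exists gs, (fun i => n%:R / r i), (fun i => i.+1%:R); split.
- by move=> i; rewrite divr_gt0 ?ltr0n.
- apply/cvgryPge => A; near=> i.
  (* The goal A r <= n reads rho1 A / (2 (i + 1)^2) <= n, so i >= rho1 A together with n >= 1 is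
     enough. *)
  have iA : rho1 * A <= i%:R by near: i; exact: nbhs_infty_ger.
  rewrite ler_pdivlMr // /r /rho.
  have n1 : (1 : R) <= n%:R by rewrite ler1n.
  have i1 : (0 : R) < i.+1%:R by [].
  have iI : i%:R <= i.+1%:R :> R by rewrite ler_nat.
  have I1 : 1 <= i.+1%:R :> R by rewrite ler1n.
  move: n1 iA i1 iI I1; move: (n%:R) (i.+1%:R) (i%:R) => a I j n1 iA i1 iI I1.
  have -> : A * (rho1 * I^-1 / (2 * I)) = rho1 * A / (2 * (I * I)) by field; lra.
  rewrite ler_pdivrMr ?mulr_gt0 // (le_trans iA) // (le_trans iI) //.
  have II : I <= I * I by rewrite ler_peMl // ltW.
  have : I * I <= a * (I * I) by rewrite ler_peMl // mulr_ge0 // ltW.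
  by move=> h; lra.
- apply/cvgryPge => A; near=> i; rewrite -natr1.
  have : A <= i%:R by near: i; exact: nbhs_infty_ger.
  by move=> h; lra.
- have exL i : exists L, is_Lnorm g (gs i) (n.+1%:R / 2) L /\ 0 <= L <= C * rho i ^+ 2.
    have [_ /(_ _ (hgs i)) [L h1 h2]] := HC _ (rho_le i).
    by exists L; split.
  have [L hL] := choice exL.
  exists L; split; first by move=> i; have [] := hL i.
  have c0 : (fun i : nat => (0 : R)) @ \oo --> (0 : R) by exact: cvg_cst.
  have c1 : (fun i => C * rho i ^+ 2) @ \oo --> (0 : R).
    have cr : rho @ \oo --> (0 : R).
      by rewrite -(mulr0 rho1); apply: cvgM; [exact: cvg_cst|exact: cvg_harmonic].
    have -> : (fun i => C * rho i ^+ 2) = (fun i => C * (rho i * rho i)).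
      by apply/funext => i; rewrite expr2.
    rewrite -(mulr0 C) -(mulr0 0); apply: cvgM; first exact: cvg_cst.
    exact: cvgM.
  apply: (squeeze_cvgr _ c0 c1); apply: nearW => i.
  by have [] := hL i.
- move=> i; have [DI _] := HC _ (rho_le i).
  exact: flat_disc_balls (rho_gt0 i) DI (hgs i).
Unshelve. all: by end_near. Qed.
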